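(* Let $P=\prod_{j=1}^k(y-q^{l_j})$ with $l_1,\dots,l_k\in\mathbb{Z}$ and let $Q\in t\,\mathbf{k}[q^{\pm1}](\!(x)\!)[y^{\pm1}][[t]]$. Then the space of solutions of the equation $$(P+Q)f=0,\qquad f\in\mathbf{k}(q)(\!(x)\!)[\log_qx][[t]],$$ is a free $\mathbf{k}(q)[[t]]$-module of rank $k$. Moreover, after an extension of scalars (to $\overline{\mathbf{k}(q)}(\!(t^{1/L})\!)$ for some integer $L\ge1$), the module of solutions has a basis $f_1,\dots,f_k$ with $$f_i\in x^{\lambda_i}\,\overline{\mathbf{k}(q)}(\!(x)\!)[[t^{1/L}]][\log_qx],\qquad q^{\lambda_i}-1\in t^{1/L}\,\overline{\mathbf{k}(q)}[[t^{1/L}]],\quad i=1,\dots,k,$$ where the degrees of the $f_i$ (i.e. of the factors $x^{-\lambda_i}f_i$) as polynomials in $\log_qx$ are smaller than $k$.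
   Context: $\mathbf{k}$ is a field of characteristic zero and $q$ is an indeterminate; $\overline{\mathbf{k}(q)}$ is an algebraic closure of $\mathbf{k}(q)$; $t$ is a formal parameter. Operators in $x,y$ satisfy $yx=qxy$, $q$ central, and act on $\mathbf{k}(q)(\!(x)\!)[\log_qx][[t]]$ by: $x$ acts by multiplication by $x$ and $y$ acts as the $q$-shift $f(x)\mapsto f(qx)$; in particular $y(\log_qx)=\log_qx+1$, where $\log_q x$ is a formal symbol. Since $q^{\lambda_i}-1\in t^{1/L}\overline{\mathbf{k}(q)}[[t^{1/L}]]$, one writes $\lambda_i\log q:=\log(q^{\lambda_i})\in t^{1/L}\overline{\mathbf{k}(q)}[[t^{1/L}]]$, and $x^{\lambda_i}$ is understood as $$x^{\lambda_i}=e^{\lambda_i\log q\,\log_qx}=\sum_{m\ge0}\frac{(\lambda_i\log q)^m(\log_qx)^m}{m!}\in\overline{\mathbf{k}(q)}(\!(x)\!)[\log_qx][[t^{1/L}]].$$ *)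

(* Defs.v *)
From HB Require Import structures.
From mathcomp Require Import all_boot all_order all_algebra.
From mathcomp Require Import finmap.
From mathcomp Require Import boolp classical_sets cardinality fsbigop.

Set Implicit Arguments.
Unset Strict Implicit.
Unset Printing Implicit Defensive.

Import GRing.Theory Num.Theory Order.TTheory.
Local Open Scope ring_scope.

Record fps (R : Type) := FPS { fps_coef :> nat -> R }.

Notation "{ 'fps' R }" := (fps R) (at level 0, format "{ 'fps'  R }").

HB.instance Definition _ (R : Type) := gen_eqMixin {fps R}.
HB.instance Definition _ (R : Type) := gen_choiceMixin {fps R}.

Lemma fpsP (R : Type) (a b : {fps R}) : a =1 b <-> a = b.
Proof.
split=> [|->//]; case: a b => [a] [b] /= ab.
by congr FPS; apply: funext.
Qed.

Section FpsRing.
Variable R : comNzRingType.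
Implicit Types a b c : {fps R}.

Definition fpsC (c : R) : {fps R} := FPS (fun n => if n == 0%N then c else 0).
Definition fps_add a b : {fps R} := FPS (fun n => a n + b n).
Definition fps_opp a : {fps R} := FPS (fun n => - a n).
Definition fps_mul a b : {fps R} :=
  FPS (fun n => \sum_(i < n.+1) a i * b (n - i)%N).

Let trunc n a : {poly R} := \poly_(i < n.+1) a i.

Let coef_trunc n a i : (i <= n)%N -> (trunc n a)`_i = a i.
Proof. by move=> le_in; rewrite coef_poly ltnS le_in. Qed.

Let coef_truncM n a b i : (i <= n)%N ->
  (trunc n a * trunc n b)`_i = fps_mul a b i.
Proof.
move=> le_in; rewrite coefM; apply: eq_bigr => j _.
rewrite !coef_trunc //; first by apply: leq_trans le_in; rewrite leq_subr.
by apply: leq_trans le_in; rewrite -ltnS.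
Qed.

Fact fps_addA : associative fps_add.
Proof. by move=> a b c; apply/fpsP => n /=; rewrite addrA. Qed.
Fact fps_addC : commutative fps_add.
Proof. by move=> a b; apply/fpsP => n /=; rewrite addrC. Qed.
Fact fps_add0 : left_id (fpsC 0) fps_add.
Proof. by move=> a; apply/fpsP => n /=; rewrite if_same add0r. Qed.
Fact fps_addN : left_inverse (fpsC 0) fps_opp fps_add.
Proof. by move=> a; apply/fpsP => n /=; rewrite if_same addNr. Qed.

HB.instance Definition _ :=
  GRing.isZmodule.Build {fps R} fps_addA fps_addC fps_add0 fps_addN.

Fact fps_mulC : commutative fps_mul.
Proof.
by move=> a b; apply/fpsP => n; rewrite -!(@coef_truncM n) // mulrC.
Qed.
Fact fps_mulA : associative fps_mul.
Proof.
move=> a b c; apply/fpsP => n.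
have -> : fps_mul a (fps_mul b c) n =
    (trunc n a * (trunc n b * trunc n c))`_n.
  rewrite coefM; apply: eq_bigr => i _.
  by rewrite coef_trunc ?coef_truncM ?leq_subr // -ltnS.
rewrite mulrA coefM; apply: eq_bigr => i _.
by rewrite coef_trunc ?coef_truncM ?leq_subr // -ltnS.
Qed.
Fact fps_mul1 : left_id (fpsC 1) fps_mul.
Proof.
move=> a; apply/fpsP => n /=.
by rewrite big_ord_recl big1 /= ?subn0 ?mul1r ?addr0 // => i _; rewrite mul0r.
Qed.
Fact fps_mulDl : left_distributive fps_mul fps_add.
Proof.
move=> a b c; apply/fpsP => n /=; rewrite -big_split /=.
by apply: eq_bigr => i _; rewrite mulrDl.
Qed.
Fact fps_1neq0 : fpsC 1 != 0.
Proof.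
by apply/eqP => /fpsP/(_ 0%N)/= /eqP; rewrite oner_eq0.
Qed.

HB.instance Definition _ := GRing.Zmodule_isComNzRing.Build {fps R}
  fps_mulA fps_mulC fps_mul1 fps_mulDl fps_1neq0.

Lemma fps0E n : (0 : {fps R}) n = 0.
Proof. exact: if_same. Qed.
Lemma fps1E n : (1 : {fps R}) n = (n == 0%N)%:R.
Proof. by rewrite /=; case: eqP. Qed.
Lemma fpsDE a b n : (a + b) n = a n + b n. Proof. by []. Qed.
Lemma fpsNE a n : (- a) n = - a n. Proof. by []. Qed.
Lemma fpsME a b n : (a * b) n = \sum_(i < n.+1) a i * b (n - i)%N.
Proof. by []. Qed.

End FpsRing.

Section FpsMap.
Variables (R S : comNzRingType) (f : {rmorphism R -> S}).

Definition fps_map (a : {fps R}) : {fps S} := FPS (fun n => f (a n)).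

Fact fps_map_is_zmod_morphism : zmod_morphism fps_map.
Proof. by move=> a b; apply/fpsP => n /=; rewrite rmorphB. Qed.
Fact fps_map_is_monoid_morphism : monoid_morphism fps_map.
Proof.
split=> [|a b]; apply/fpsP => n /=.
  by case: eqP; rewrite ?rmorph1 ?rmorph0.
rewrite rmorph_sum /=; apply: eq_bigr => i _; exact: rmorphM.
Qed.

HB.instance Definition _ :=
  GRing.isZmodMorphism.Build {fps R} {fps S} fps_map fps_map_is_zmod_morphism.
HB.instance Definition _ :=
  GRing.isMonoidMorphism.Build {fps R} {fps S} fps_map
    fps_map_is_monoid_morphism.

End FpsMap.

(* The composite c(u); it is the expected series only when u has zero
   constant term, since then u ^+ m has no coefficient below degree m. *)
Definition fps_comp (R : comNzRingType) (c u : {fps R}) : {fps R} :=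
  FPS (fun n => \sum_(m < n.+1) c m * (u ^+ m) n).

(* The substitution t := s^L. *)
Definition fps_ramify (R : comNzRingType) (L : nat) (a : {fps R}) : {fps R} :=
  FPS (fun n => if (L %| n)%N then a (n %/ L)%N else 0).

Definition fps_exp_series (E : fieldType) : {fps E} := FPS (fun m => m`!%:R^-1).

Definition fps_log1p_series (E : fieldType) : {fps E} :=
  FPS (fun m => if m is m'.+1 then (-1) ^+ m' / m%:R else 0).

Definition fps_log (E : fieldType) (a : {fps E}) : {fps E} :=
  fps_comp (fps_log1p_series E) (a - 1).

Record laurent (R : nmodType) := Laurent {
  laurent_coef :> int -> R;
  laurent_bounded : exists N : int, forall n, n < N -> laurent_coef n = 0
}.

Notation "{ 'laurent' R }" := (laurent R)
  (at level 0, format "{ 'laurent'  R }").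

HB.instance Definition _ (R : nmodType) := gen_eqMixin {laurent R}.
HB.instance Definition _ (R : nmodType) := gen_choiceMixin {laurent R}.

Lemma laurentP (R : nmodType) (a b : {laurent R}) : a =1 b <-> a = b.
Proof.
split=> [|->//]; case: a b => [a pa] [b pb] /= /funext ab.
by case: _ / ab pb => pb; congr Laurent; apply: Prop_irrelevance.
Qed.

Section LaurentRing.
Variable R : comNzRingType.
Implicit Types a b c : {laurent R}.

Fact laurentC_bounded (c : R) :
  exists N : int, forall n : int, n < N -> (if n == 0 then c else 0) = 0.
Proof. by exists 0 => n; rewrite lt_neqAle => /andP[/negPf->]. Qed.
Definition laurentC (c : R) : {laurent R} := Laurent (laurentC_bounded c).

Fact laurent_add_bounded a b :
  exists N : int, forall n, n < N -> a n + b n = 0.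
Proof.
have [[M aM] [N bN]] := (laurent_bounded a, laurent_bounded b).
exists (Order.min M N) => n; rewrite lt_min => /andP[nM nN].
by rewrite aM ?bN ?addr0.
Qed.
Definition laurent_add a b : {laurent R} := Laurent (laurent_add_bounded a b).

Fact laurent_opp_bounded a : exists N : int, forall n, n < N -> - a n = 0.
Proof.
by have [M aM] := laurent_bounded a; exists M => n /aM->; rewrite oppr0.
Qed.
Definition laurent_opp a : {laurent R} := Laurent (laurent_opp_bounded a).

(* Only finitely many terms of this sum over all integers are nonzero. *)
Definition laurent_conv a b (n : int) : R :=
  \sum_(i \in [set: int]%classic) a i * b (n - i).

Lemma laurent_convE a b (M N : int) (m : nat) (n : int) :
    (forall i, i < M -> a i = 0) -> (forall i, i < N -> b i = 0) ->
    n < M + N + m%:Z ->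
  laurent_conv a b n = \sum_(i < m) a (M + i%:Z) * b (n - (M + i%:Z)).
Proof.
move=> aM bN lt_n; pose s := [seq M + i%:Z | i <- iota 0 m].
have us : uniq s.
  by rewrite map_inj_uniq ?iota_uniq // => i j /addrI[].
rewrite /laurent_conv -(@fsbig_widen _ _ _ _ [set` s]%classic) //.
  rewrite -fsbig_seq // big_map.
  by rewrite -[m in iota 0 m]subn0 -/(index_iota 0 m) big_mkord.
move=> i [_ /= nsi]; case: (ltP i M) => [/aM->|Mi]; first by rewrite mul0r.
case: (ltP (n - i) N) => [/bN->|Ni]; first by rewrite mulr0.
case: nsi; apply/mapP; exists `|i - M|%N.
  rewrite mem_iota /= add0n -ltz_nat gez0_abs ?subr_ge0 //.
  rewrite ltrBlDl; apply: le_lt_trans (_ : n - N < _).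
    by rewrite lerBrDl -lerBrDr.
  by rewrite ltrBlDr addrAC.
by rewrite gez0_abs ?subr_ge0 // [M + _]addrC subrK.
Qed.

Fact laurent_mul_bounded a b :
  exists N : int, forall n, n < N -> laurent_conv a b n = 0.
Proof.
have [[M aM] [N bN]] := (laurent_bounded a, laurent_bounded b).
exists (M + N) => n lt_n.
by rewrite (@laurent_convE a b M N 0) ?addr0 // big_ord0.
Qed.
Definition laurent_mul a b : {laurent R} := Laurent (laurent_mul_bounded a b).

Fact laurent_addA : associative laurent_add.
Proof. by move=> a b c; apply/laurentP => n /=; rewrite addrA. Qed.
Fact laurent_addC : commutative laurent_add.
Proof. by move=> a b; apply/laurentP => n /=; rewrite addrC. Qed.
Fact laurent_add0 : left_id (laurentC 0) laurent_add.
Proof. by move=> a; apply/laurentP => n /=; rewrite if_same add0r. Qed.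
Fact laurent_addN : left_inverse (laurentC 0) laurent_opp laurent_add.
Proof. by move=> a; apply/laurentP => n /=; rewrite if_same addNr. Qed.

HB.instance Definition _ := GRing.isZmodule.Build {laurent R}
  laurent_addA laurent_addC laurent_add0 laurent_addN.

(* The series x^N p(x). *)
Definition laurent_shift_coef (N : int) (p : {fps R}) (n : int) : R :=
  if N <= n then p `|n - N|%N else 0.

Fact laurent_shift_bounded N p :
  exists M : int, forall n, n < M -> laurent_shift_coef N p n = 0.
Proof. by exists N => n; rewrite /laurent_shift_coef ltNge => /negPf->. Qed.
Definition laurent_shift N p : {laurent R} :=
  Laurent (laurent_shift_bounded N p).

Lemma laurent_shiftP a : exists N p, a = laurent_shift N p.
Proof.
have [N aN] := laurent_bounded a.
exists N, (FPS (fun n => a (N + n%:Z))); apply/laurentP => n /=.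
rewrite /laurent_shift_coef; case: leP => [Nn|/aN//] /=.
by rewrite gez0_abs ?subr_ge0 // [N + _]addrC subrK.
Qed.

Let shift_lt N p n : n < N -> laurent_shift N p n = 0.
Proof. by rewrite /= /laurent_shift_coef ltNge => /negPf->. Qed.

Let shift_ge N p (n : nat) : laurent_shift N p (N + n%:Z) = p n.
Proof. by rewrite /= /laurent_shift_coef lerDl /= addrAC subrr add0r absz_nat. Qed.

Lemma laurent_shiftM M N p r :
  laurent_mul (laurent_shift M p) (laurent_shift N r) =
  laurent_shift (M + N) (p * r).
Proof.
apply/laurentP => n; rewrite [LHS]/=; case: (ltP n (M + N)) => [lt_n|le_n].
  rewrite (@laurent_convE _ _ M N 0) ?addr0 ?big_ord0 ?shift_lt //;
    by move=> i; apply: shift_lt.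
have [m ->] : exists m : nat, n = M + N + m%:Z.
  by exists `|n - (M + N)%R|%N; rewrite gez0_abs ?subr_ge0 // [RHS]addrC subrK.
rewrite shift_ge (@laurent_convE _ _ M N m.+1);
  [|exact: shift_lt|exact: shift_lt|by rewrite ltrD2l ltz_nat].
apply: eq_bigr => i _; rewrite shift_ge; congr (_ * _).
rewrite -(shift_ge N); congr (laurent_shift N r _).
rewrite -subzn -1?ltnS //.
by rewrite [M + N]addrC -!addrA; congr (_ + _); rewrite addrA opprD addrAC addrA subrr add0r addrC.
Qed.

Lemma laurentCE (c : R) : laurentC c = laurent_shift 0 (fpsC c).
Proof.
apply/laurentP => n /=; rewrite /laurent_shift_coef subr0 /= absz_eq0.
by case: eqP => [->|]; rewrite ?lexx ?if_same.
Qed.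

Fact laurent_mulC : commutative laurent_mul.
Proof.
move=> a b; have [[M [p ->]] [N [r ->]]] := (laurent_shiftP a, laurent_shiftP b).
by rewrite !laurent_shiftM mulrC [N + M]addrC.
Qed.
Fact laurent_mulA : associative laurent_mul.
Proof.
move=> a b c; have [M [p ->]] := laurent_shiftP a.
have [[N [r ->]] [K [u ->]]] := (laurent_shiftP b, laurent_shiftP c).
by rewrite !laurent_shiftM mulrA addrA.
Qed.
Fact laurent_mul1 : left_id (laurentC 1) laurent_mul.
Proof.
move=> a; have [M [p ->]] := laurent_shiftP a.
by rewrite laurentCE laurent_shiftM add0r [X in laurent_shift _ X]mul1r.
Qed.
Fact laurent_mulDl : left_distributive laurent_mul laurent_add.
Proof.
move=> a b c; apply/laurentP => n /=.
have [K cK] := laurent_bounded c.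
have [[M aM] [N bN]] := (laurent_bounded a, laurent_bounded b).
pose H := Order.min M N.
have aH i : i < H -> a i = 0 by rewrite lt_min => /andP[/aM].
have bH i : i < H -> b i = 0 by rewrite lt_min => /andP[_ /bN].
pose m := `|n - (H + K)%R|%N.+1.
have ltm : n < H + K + m%:Z.
  by rewrite -ltrBlDl /m (le_lt_trans (ler_norm _)) // -abszE ltz_nat.
have abH i : i < H -> laurent_add a b i = 0.
  by move=> iH /=; rewrite aH ?bH ?addr0.
rewrite !(@laurent_convE _ _ H K m) // -big_split /=.
by apply: eq_bigr => i _; rewrite mulrDl.
Qed.
Fact laurent_1neq0 : laurentC 1 != 0.
Proof. by apply/eqP => /laurentP/(_ 0)/= /eqP; rewrite oner_eq0. Qed.

HB.instance Definition _ := GRing.Zmodule_isComNzRing.Build {laurent R}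
  laurent_mulA laurent_mulC laurent_mul1 laurent_mulDl laurent_1neq0.

Lemma laurent0E n : (0 : {laurent R}) n = 0.
Proof. exact: if_same. Qed.
Lemma laurentDE a b n : (a + b) n = a n + b n. Proof. by []. Qed.
Lemma laurentNE a n : (- a) n = - a n. Proof. by []. Qed.
Lemma laurentME a b n :
  (a * b) n = \sum_(i \in [set: int]%classic) a i * b (n - i).
Proof. by []. Qed.

Fact laurentC_is_zmod_morphism : zmod_morphism laurentC.
Proof.
move=> c d; apply/laurentP => n; rewrite laurentDE laurentNE /=.
by case: eqP; rewrite ?subr0.
Qed.
Fact laurentC_is_monoid_morphism : monoid_morphism laurentC.
Proof.
split=> // c d; rewrite !laurentCE [RHS]laurent_shiftM addr0.
congr laurent_shift; apply/fpsP => n; rewrite fpsME big_ord_recl big1 => [|i _].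
  by rewrite /= subn0 addr0; case: eqP; rewrite ?mulr0.
by rewrite /= mul0r.
Qed.
HB.instance Definition _ := GRing.isZmodMorphism.Build R {laurent R} laurentC
  laurentC_is_zmod_morphism.
HB.instance Definition _ := GRing.isMonoidMorphism.Build R {laurent R} laurentC
  laurentC_is_monoid_morphism.

Definition laurent_of_fps (p : {fps R}) : {laurent R} := laurent_shift 0 p.

End LaurentRing.

Section LaurentMap.
Variables (R S : comNzRingType) (f : {rmorphism R -> S}).

Fact laurent_map_bounded (a : {laurent R}) :
  exists N : int, forall n, n < N -> f (a n) = 0.
Proof.
by have [N aN] := laurent_bounded a; exists N => n /aN->; rewrite rmorph0.
Qed.
Definition laurent_map (a : {laurent R}) : {laurent S} :=
  Laurent (laurent_map_bounded a).

Lemma laurent_map_shift N p :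
  laurent_map (laurent_shift N p) = laurent_shift N (fps_map f p).
Proof.
by apply/laurentP => n /=; rewrite /laurent_shift_coef; case: ifP; rewrite ?rmorph0.
Qed.

Fact laurent_map_is_zmod_morphism : zmod_morphism laurent_map.
Proof. by move=> a b; apply/laurentP => n /=; rewrite rmorphB. Qed.
Fact laurent_map_is_monoid_morphism : monoid_morphism laurent_map.
Proof.
split=> [|a b].
  by apply/laurentP => n /=; case: eqP; rewrite ?rmorph1 ?rmorph0.
have [[M [p ->]] [N [r ->]]] := (laurent_shiftP a, laurent_shiftP b).
rewrite -[laurent_shift M p * _]/(laurent_mul _ _) laurent_shiftM.
by rewrite !laurent_map_shift rmorphM [RHS]laurent_shiftM.
Qed.
HB.instance Definition _ := GRing.isZmodMorphism.Build {laurent R} {laurent S}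
  laurent_map laurent_map_is_zmod_morphism.
HB.instance Definition _ := GRing.isMonoidMorphism.Build {laurent R} {laurent S}
  laurent_map laurent_map_is_monoid_morphism.

End LaurentMap.

(* E((x))[log_q x] is {poly {laurent E}}: the polynomial variable 'X is the
  formal symbol log_q x, and E((x))[log_q x][[t]] is
  {fps {poly {laurent E}}}. *)

Definition logconst (E : comNzRingType) : {rmorphism E -> {poly {laurent E}}} :=
  polyC \o @laurentC E.

(* The scalars E[[t]] inside E((x))[log_q x][[t]]. *)
Definition fps_scalar (E : comNzRingType) :
    {rmorphism {fps E} -> {fps {poly {laurent E}}}} :=
  fps_map (logconst E).

(* The scalars E((t)) inside E((x))[log_q x]((t)). *)
Definition laurent_scalar (E : comNzRingType) :
    {rmorphism {laurent E} -> {laurent {poly {laurent E}}}} :=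
  laurent_map (logconst E).

(* The inclusion of A[[t]][log] into A[log][[t]]. *)
Definition fps_of_poly (A : comNzRingType) (h : {poly {fps A}}) :
    {fps {poly A}} :=
  FPS (fun n => map_poly (fun a : {fps A} => a n) h).

(* x^lambda = exp (lambda log q . log_q x), as a function of
   mu = q^lambda in 1 + t E[[t]]; the exponent lambda itself occurs only
   through lambda log q = log mu. *)
Definition xpow (E : fieldType) (mu : {fps E}) : {fps {poly {laurent E}}} :=
  fps_comp (fps_scalar E (fps_exp_series E))
           (fps_scalar E (fps_log mu) * fpsC 'X).

Section QOperators.
Variables (E : fieldType) (q : E).

Fact qshift_laurent_bounded (j : int) (a : {laurent E}) :
  exists N : int, forall n, n < N -> q ^ (j * n) * a n = 0.
Proof.
by have [N aN] := laurent_bounded a; exists N => n /aN->; rewrite mulr0.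
Qed.
(* a(x) |-> a(q^j x). *)
Definition qshift_laurent (j : int) (a : {laurent E}) : {laurent E} :=
  Laurent (qshift_laurent_bounded j a).

(* The action of y^j: x |-> q^j x and log_q x |-> log_q x + j. *)
Definition qshift (j : int) (f : {poly {laurent E}}) : {poly {laurent E}} :=
  map_poly (qshift_laurent j) f \Po ('X + j%:~R%:P).

(* An element of E((x))[y^{+-1}] is written \sum_j D_j(x) y^j, with
   coefficients on the left of the powers of y. *)
Definition qdiffop := {fsfun int -> {laurent E} with 0}.

Definition qdiffop_app (D : qdiffop) (f : {poly {laurent E}}) :
    {poly {laurent E}} :=
  \sum_(j <- finsupp D) D j *: qshift j f.

(* An element of E((x))[y^{+-1}][[t]] is the sequence of its t-coefficients. *)
Definition qdiffop_fps := nat -> qdiffop.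

Definition qdiffop_fps_app (Q : qdiffop_fps) (f : {fps {poly {laurent E}}}) :
    {fps {poly {laurent E}}} :=
  FPS (fun n => \sum_(i < n.+1) qdiffop_app (Q i) (f (n - i)%N)).

(* The action of y - c for a scalar c. *)
Definition yminus (c : E) (f : {fps {poly {laurent E}}}) :
    {fps {poly {laurent E}}} :=
  FPS (fun n => qshift 1 (f n)) - fpsC (logconst E c) * f.

(* The action of (y - q^{l_1}) ... (y - q^{l_k}). *)
Definition yprod_app (l : seq int) (f : {fps {poly {laurent E}}}) :
    {fps {poly {laurent E}}} :=
  foldr (fun lj g => yminus (q ^ lj) g) f l.

Definition solution (l : seq int) (Q : qdiffop_fps)
    (f : {fps {poly {laurent E}}}) : Prop :=
  yprod_app l f + qdiffop_fps_app Q f = 0.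

End QOperators.

Definition qvar (F : fieldType) : {fraction {poly F}} := tofrac 'X.

Definition is_qlaurent (F : fieldType) (c : {fraction {poly F}}) : Prop :=
  exists (p : {poly F}) (N : nat), c = tofrac p / qvar F ^+ N.

(* M is a free A-submodule of the A-algebra B, with basis g_1, ..., g_k. *)
Definition free_basis (A B : comNzRingType) (phi : {rmorphism A -> B})
    (M : B -> Prop) (k : nat) (g : 'I_k -> B) : Prop :=
  (forall f, M f <-> exists c : 'I_k -> A, f = \sum_(i < k) phi (c i) * g i) /\
  (forall c : 'I_k -> A, \sum_(i < k) phi (c i) * g i = 0 -> forall i, c i = 0).

(* The extension of scalars of a module M, realised inside the A-algebra B:
   the A-span of the image of M under iota : B0 -> B. *)
Definition scalar_extension (A B0 B : comNzRingType) (phi : {rmorphism A -> B})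
    (iota : B0 -> B) (M : B0 -> Prop) (h : B) : Prop :=
  exists (n : nat) (c : 'I_n -> A) (m : 'I_n -> B0),
    (forall i, M (m i)) /\ h = \sum_(i < n) phi (c i) * iota (m i).

(* The map K((x))[log_q x][[t]] -> K'((x))[log_q x]((s)), t = s^L, induced by
   a field extension K -> K'. *)
Definition ext_map (K K' : fieldType) (iota : {rmorphism K -> K'}) (L : nat)
    (f : {fps {poly {laurent K}}}) : {laurent {poly {laurent K'}}} :=
  laurent_of_fps
    (fps_ramify L (fps_map (map_poly (laurent_map iota)) f)).

(* Main.v *)
(* The operator P maps K((x))[log_q x] onto itself, and its kernel has dimension
   k: each factor y - q^a is onto, with kernel K x^a. Solving degree by degree
   in t, every element of ker P lifts to a solution of (P + Q) f = 0, so the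
   lifts of a basis of ker P form a basis of the solutions.

   The substitution T : log_q x -> log_q x + 1 commutes with x and y, hence acts
   on the solutions by a matrix A over K[[t]]. By Puiseux's theorem the
   characteristic polynomial of A splits over Kbar[[s]], s^L = t, and its roots
   mu have constant term 1, because T multiplies no nonzero element of
   Kbar((x))[log_q x] by a scalar other than 1. Over Kbar((s)) there is a basis
   of generalized eigenvectors f, (T - mu)^k f = 0. As T (x^lambda) =
   mu x^lambda for mu = q^lambda, the series x^(-lambda) f is killed by
   (T - 1)^k, that is, its degree in log_q x is less than k. *)

From HB Require Import structures.
Require Import Defs.
From mathcomp Require Import all_boot all_order all_algebra.
From mathcomp Require Import finmap.
From mathcomp Require Import boolp zify ring.

Set Implicit Arguments.
Unset Strict Implicit.
Unset Printing Implicit Defensive.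

Import GRing.Theory Num.Theory Order.TTheory.
Local Open Scope ring_scope.

(** * Formal power series *)

(** Generalized eigenvectors exist over the field [Kbar((s))], whereas x^lambda and the degree in
    log_q x are handled in power series. One power of s clears the denominators of all eigenvectors
    at once, so the k combinations obtained are power series; their matrix [W] is invertible only
    once s is inverted. The roots mu need no such correction: the characteristic polynomial is
    monic, so they already lie in [Kbar[[s]]], and log mu makes sense as soon as their constant term
    is 1. One fact is carried along from the kernel of P onwards: the constant terms in t of the
    basis of solutions stay independent over Kbar. It gives independence over [Kbar[[s]]] and
    [Kbar((s))] by comparing lowest-order terms, and at s = 0 it turns an eigenvector of the reduced
    matrix of T into a nonzero element of [Kbar((x))[log_q x]]. The exponent k serves every
    coefficient in s at once. This uniformity makes x^(-lambda) f a polynomial in log_q x with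
    series coefficients, and not merely a series of polynomials. *)

Lemma sequence_recursion (T : Type) (x0 : T)
    (R : nat -> (nat -> T) -> T -> Prop) :
    (forall n u, exists x, R n u x) ->
    (forall n u v x, (forall i, (i < n)%N -> u i = v i) ->
       R n u x -> R n v x) ->
  exists u, forall n, R n u (u n).
Proof.
move=> exR extR.
have /choice[step stepP] : forall nu : nat * (nat -> T),
  exists x, R nu.1 nu.2 x by move=> nu; apply: exR.
pose build := fix build n :=
  if n is m.+1 then rcons (build m) (step (m, nth x0 (build m))) else [::].
have size_build n : size (build n) = n.
  by elim: n => //= n IHn; rewrite size_rcons IHn.
pose u i := nth x0 (build i.+1) i.
have uE n i : (i < n)%N -> nth x0 (build n) i = u i.
  elim: n => // n IHn; rewrite ltnS leq_eqVlt => /predU1P[->//|lt_in].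
  by rewrite /= nth_rcons size_build lt_in IHn.
(* [step] sees the first n values padded with [x0]; [extR] discards the padding. *)
exists u => n; apply: extR (uE n) _.
have -> : u n = step (n, nth x0 (build n)).
  by rewrite /u /= nth_rcons size_build ltnn eqxx.
exact: stepP (n, _).
Qed.

Section FpsTheory.
Variable R : comNzRingType.
Implicit Types a b c u v : {fps R}.

Lemma fps_sumE (I : Type) (r : seq I) (P : pred I) (G : I -> {fps R}) n :
  (\sum_(i <- r | P i) G i) n = \sum_(i <- r | P i) G i n.
Proof.
elim/big_rec2: _ => [|i y1 y2 _ <-]; [exact: fps0E | exact: fpsDE].
Qed.

Lemma fps_natE a m n : (a *+ m) n = a n *+ m.
Proof. by elim: m => [|m IHm]; rewrite ?mulr0n ?fps0E // !mulrS fpsDE IHm. Qed.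

(** Coefficient n of a product involves only coefficients up to n, so polynomial identities pass to
    series through truncations. *)
Lemma fpsM_poly n a b (p r : {poly R}) :
    (forall i, (i <= n)%N -> a i = p`_i) ->
    (forall i, (i <= n)%N -> b i = r`_i) ->
  (a * b) n = (p * r)`_n.
Proof.
move=> ap br; rewrite fpsME coefM; apply: eq_bigr => i _.
by rewrite ap ?br ?leq_subr // -ltnS.
Qed.

Lemma fpsM0E a b : (a * b) 0%N = a 0%N * b 0%N.
Proof. by rewrite fpsME big_ord1. Qed.

Lemma fpsM_eq n a a' b b' :
    (forall i, (i <= n)%N -> a i = a' i) ->
    (forall i, (i <= n)%N -> b i = b' i) ->
  (a * b) n = (a' * b') n.
Proof.
move=> aa bb; rewrite !fpsME; apply: eq_bigr => i _.
by rewrite aa ?bb ?leq_subr // -ltnS.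
Qed.

Lemma fpsCM (c : R) a n : (fpsC c * a) n = c * a n.
Proof.
by rewrite fpsME big_ord_recl big1 /= ?subn0 ?addr0 // => i _; rewrite mul0r.
Qed.

Let trunc n a : {poly R} := \poly_(i < n.+1) a i.
Let truncE n a i : (i <= n)%N -> a i = (trunc n a)`_i.
Proof. by move=> le_in; rewrite coef_poly ltnS le_in. Qed.

Fact fps_ramify_is_zmod_morphism L : zmod_morphism (@fps_ramify R L).
Proof.
move=> a b; apply/fpsP => n; rewrite fpsDE fpsNE /=.
by case: ifP => _; rewrite ?subr0.
Qed.

Fact fps_ramify_is_monoid_morphism L : monoid_morphism (@fps_ramify R L.+1).
Proof.
split=> [|a b]; apply/fpsP => n.
  rewrite [LHS]/= fps1E; have [/dvdnP[m ->]|nL] := boolP (L.+1 %| n)%N.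
    by rewrite mulnK // muln_eq0 orbF; case: eqP.
  by case: eqP nL => // ->; rewrite dvdn0.
(* On truncations, t := s^(L+1) is a polynomial composition, which is multiplicative. *)
pose s c := trunc n c \Po 'X^(L.+1).
have sE c i : (i <= n)%N -> fps_ramify L.+1 c i = (s c)`_i.
  move=> le_in; rewrite coef_comp_poly_Xn //= -truncE //.
  exact: leq_trans (leq_div _ _) le_in.
rewrite (fpsM_poly (sE a) (sE b)) -comp_polyM coef_comp_poly_Xn //=.
have le_d : (n %/ L.+1 <= n)%N := leq_div _ _.
case: ifP => // _; apply: fpsM_poly => i le_i.
  by apply: truncE; apply: leq_trans le_d.
by apply: truncE; apply: leq_trans le_d.
Qed.

HB.instance Definition _ L :=
  GRing.isZmodMorphism.Build {fps R} {fps R} (@fps_ramify R L)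
    (fps_ramify_is_zmod_morphism L).
HB.instance Definition _ L :=
  GRing.isMonoidMorphism.Build {fps R} {fps R} (@fps_ramify R L.+1)
    (fps_ramify_is_monoid_morphism L).

Lemma fps_ramify0E L a : fps_ramify L a 0%N = a 0%N.
Proof. by rewrite /= dvdn0 div0n. Qed.

Lemma fps_ramifyM L M a :
  fps_ramify L.+1 (fps_ramify M.+1 a) = fps_ramify (M.+1 * L.+1) a.
Proof.
apply/fpsP => n /=; case: ifP => [/dvdnP[m ->]|nL].
  by rewrite mulnK // dvdn_pmul2r // divnMr.
by case: ifP => // nML; rewrite (dvdn_trans _ nML) ?dvdn_mull in nL.
Qed.

Definition fps_deriv a : {fps R} := FPS (fun n => a n.+1 *+ n.+1).

Lemma fps_derivM a b :
  fps_deriv (a * b) = fps_deriv a * b + a * fps_deriv b.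
Proof.
apply/fpsP => n; rewrite fpsDE.
have tE c i : (i <= n)%N -> c i = (trunc n.+1 c)`_i.
  by move=> /leqW; apply: truncE.
have dE c i : (i <= n)%N -> fps_deriv c i = (trunc n.+1 c)^`()`_i.
  by move=> le_in; rewrite coef_deriv -truncE.
rewrite (fpsM_poly (dE a) (tE b)) (fpsM_poly (tE a) (dE b)) -coefD -derivM.
by rewrite coef_deriv; congr (_ *+ _); apply: fpsM_poly; apply: truncE.
Qed.

Lemma fps_derivD a b : fps_deriv (a + b) = fps_deriv a + fps_deriv b.
Proof. by apply/fpsP => n; rewrite /= mulrnDl. Qed.

Lemma fps_deriv1 : fps_deriv 1 = 0.
Proof. by apply/fpsP => n; rewrite fps0E /= mul0rn. Qed.

Lemma fps_derivXn u m : fps_deriv (u ^+ m.+1) = (u ^+ m * fps_deriv u) *+ m.+1.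
Proof.
elim: m => [|m IHm]; first by rewrite expr1 expr0 mul1r.
rewrite exprS fps_derivM IHm mulrnAr mulrA -exprS.
by rewrite [X in X + _]mulrC [in RHS]mulrS.
Qed.

Lemma fpsX_order u m n : u 0%N = 0 -> (n < m)%N -> (u ^+ m) n = 0.
Proof.
move=> u0; elim: m n => // m IHm n lt_nm; rewrite exprS fpsME.
apply: big1 => -[[|i] /= lt_in] _; first by rewrite u0 mul0r.
by rewrite IHm ?mulr0 //; lia.
Qed.

(** The power u^m starts in degree m, so the cutoff is immaterial; a cutoff common to all
    coefficients allows sums to be exchanged. *)
Lemma fps_comp_trunc c u n N : u 0%N = 0 -> (n < N)%N ->
  fps_comp c u n = \sum_(m < N) c m * (u ^+ m) n.
Proof.
move=> u0 lt_nN; rewrite /= (big_ord_widen N (fun m => c m * (u ^+ m) n)) //.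
rewrite big_mkcond; apply: eq_bigr => m _; case: ifPn => // /=.
by rewrite -leqNgt => lt_nm; rewrite fpsX_order ?mulr0.
Qed.

Lemma fps_comp0E c u : (fps_comp c u) 0%N = c 0%N.
Proof. by rewrite /= big_ord1 fps1E mulr1. Qed.

Lemma fps_deriv_comp c u : u 0%N = 0 ->
  fps_deriv (fps_comp c u) = fps_comp (fps_deriv c) u * fps_deriv u.
Proof.
move=> u0; apply/fpsP => n.
rewrite -[LHS]/((\sum_(m < n.+2) c m * (u ^+ m) n.+1) *+ n.+1).
rewrite -sumrMnl big_ord_recl fps1E mulr0 mul0rn add0r fpsME.
under eq_bigr => m _.
  rewrite -mulrnAr -[(u ^+ _) _ *+ _]/(fps_deriv (u ^+ m.+1) n) fps_derivXn.
  rewrite fps_natE mulrnAr -mulrnAl -[_ *+ _]/(fps_deriv c m) fpsME mulr_sumr.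
  over.
rewrite exchange_big; apply: eq_bigr => i _.
rewrite (@fps_comp_trunc _ _ i n.+1) // mulr_suml.
by apply: eq_bigr => m _; rewrite mulrA.
Qed.

Hypothesis torsion_free : forall (x : R) n, x *+ n.+1 = 0 -> x = 0.

(** The equation a' = a z gives (n+1) a_(n+1) from the lower coefficients, and [torsion_free]
    cancels n+1. The identities for exp and log below are obtained this way, without manipulating
    double series. *)
Lemma fps_ode_unique a b z : a 0%N = b 0%N ->
  fps_deriv a = a * z -> fps_deriv b = b * z -> a = b.
Proof.
move=> ab0 Da Db; apply/fpsP => n.
suff ab m : (m <= n)%N -> a m = b m by apply: ab.
elim: n m => [|n IHn] m; first by rewrite leqn0 => /eqP->.
rewrite leq_eqVlt => /predU1P[->|]; last exact: IHn.
apply/eqP; rewrite -subr_eq0; apply/eqP; apply: (@torsion_free _ n).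
rewrite mulrnBl -[a _ *+ _]/(fps_deriv a n) -[b _ *+ _]/(fps_deriv b n).
rewrite Da Db; apply/eqP; rewrite subr_eq0; apply/eqP.
exact: fpsM_eq.
Qed.

(** Both sides have constant term 1 and solve F' = F (u + v)'. *)
Lemma fps_expD e u v : fps_deriv e = e -> e 0%N = 1 ->
    u 0%N = 0 -> v 0%N = 0 ->
  fps_comp e (u + v) = fps_comp e u * fps_comp e v.
Proof.
move=> De e0 u0 v0; apply: (@fps_ode_unique _ _ (fps_deriv (u + v))).
- by rewrite fpsM0E !fps_comp0E e0 mulr1.
- by rewrite fps_deriv_comp ?De // fpsDE u0 v0 addr0.
- rewrite fps_derivM !fps_deriv_comp // De fps_derivD mulrDr addrC.
  by rewrite mulrA addrC; congr (_ + _); rewrite mulrAC.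
Qed.

End FpsTheory.

Lemma fps_map_comp (R S : comNzRingType) (f : {rmorphism R -> S})
    (c u : {fps R}) :
  fps_map f (fps_comp c u) = fps_comp (fps_map f c) (fps_map f u).
Proof.
apply/fpsP => n; rewrite /= rmorph_sum; apply: eq_bigr => m _.
by rewrite rmorphM -rmorphXn.
Qed.

Lemma fps_map_ramify (R S : comNzRingType) (f : {rmorphism R -> S}) L
    (a : {fps R}) :
  fps_map f (fps_ramify L a) = fps_ramify L (fps_map f a).
Proof. by apply/fpsP => n /=; case: ifP => // _; rewrite rmorph0. Qed.

Section ExpLog.
Variable E : fieldType.
Hypothesis charE : forall n, n.+1%:R != 0 :> E.

Lemma field_torsion_free (x : E) n : x *+ n.+1 = 0 -> x = 0.
Proof.
by move=> /eqP; rewrite -mulr_natr mulf_eq0 (negPf (charE n)) orbF => /eqP.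
Qed.

Lemma fps_deriv_exp : fps_deriv (fps_exp_series E) = fps_exp_series E.
Proof.
apply/fpsP => n; rewrite /= factS natrM invfM -[LHS]mulr_natr.
by rewrite mulrAC mulVf ?mul1r.
Qed.

(** Both sides have constant term 1 and solve f' = f (log mu)'. With mu = 1 + u, the equation for mu
    itself amounts to (1 + u) log1p'(u) = 1. *)
Lemma fps_exp_log (mu : {fps E}) : (mu - 1) 0%N = 0 ->
  fps_comp (fps_exp_series E) (fps_log mu) = mu.
Proof.
set u := mu - 1 => u0; have -> : mu = 1 + u by rewrite addrC subrK.
have logE : fps_log (1 + u) = fps_comp (fps_log1p_series E) u.
  by rewrite /fps_log addrC addKr.
have log0 : fps_log (1 + u) 0%N = 0 by rewrite logE fps_comp0E.
set dl := fps_comp (fps_deriv (fps_log1p_series E)) u.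
have signE m (a : {fps E}) i : ((-1) ^+ m * a) i = (-1) ^+ m * a i.
  rewrite -signr_odd -[in RHS]signr_odd.
  by case: odd; rewrite ?mul1r // !mulN1r fpsNE.
have dlK : (1 + u) * dl = 1.
  (* Up to degree n, [dl] is the geometric sum of the powers of -u. The product telescopes to 1 -
     (-u)^(n+1), whose last term has no coefficient in degree n. *)
  apply/fpsP => n; transitivity (((1 + u) * \sum_(i < n.+1) (- u) ^+ i) n).
    apply: fpsM_eq => // i le_in; rewrite (@fps_comp_trunc _ _ _ _ n.+1) //.
    rewrite fps_sumE; apply: eq_bigr => m _.
    rewrite exprNn signE /= -[X in X * _]mulr_natr divfK //.
  have := subrX1 (- u) n.+1; rewrite -opprD mulNr [u + 1]addrC.
  move=> /(congr1 (fun v : {fps E} => - v n)); rewrite !fpsNE opprK => <-.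
  by rewrite fpsDE fpsNE exprNn signE fpsX_order // mulr0 add0r opprK fps1E.
apply: (@fps_ode_unique _ field_torsion_free _ _ (fps_deriv (fps_log (1 + u)))).
- by rewrite fps_comp0E fpsDE u0 addr0 fps1E /= fact0 invr1.
- by rewrite fps_deriv_comp // fps_deriv_exp.
- rewrite logE fps_deriv_comp // mulrA -/dl dlK mul1r fps_derivD.
  by rewrite fps_deriv1 add0r.
Qed.

End ExpLog.

(** * Laurent series *)

Section LaurentOfFps.
Variable R : comNzRingType.
Implicit Types (p r : {fps R}) (a b : {laurent R}).

Lemma laurent_mul_shift M N p r :
  laurent_shift M p * laurent_shift N r = laurent_shift (M + N) (p * r).
Proof. exact: laurent_shiftM. Qed.

Lemma laurent_of_fpsE p (n : nat) : laurent_of_fps p n = p n.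
Proof. by rewrite /= /laurent_shift_coef subr0. Qed.

Lemma laurent_of_fps_inj : injective (@laurent_of_fps R).
Proof.
move=> p r pr; apply/fpsP => n.
by rewrite -[LHS]laurent_of_fpsE pr laurent_of_fpsE.
Qed.

Lemma laurent_nonneg a : (forall n : int, n < 0 -> a n = 0) ->
  exists p, a = laurent_of_fps p.
Proof.
move=> a0; exists (FPS (fun n => a n%:Z)); apply/laurentP => n /=.
rewrite /laurent_shift_coef subr0; case: leP => [n0|/a0//] /=.
by rewrite gez0_abs.
Qed.

Fact laurent_of_fps_is_zmod_morphism : zmod_morphism (@laurent_of_fps R).
Proof.
move=> p r; apply/laurentP => n; rewrite laurentDE laurentNE /=.
by rewrite /laurent_shift_coef; case: ifP; rewrite ?subr0.
Qed.

Fact laurent_of_fps_is_monoid_morphism : monoid_morphism (@laurent_of_fps R).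
Proof.
split=> [|p r]; last by rewrite laurent_mul_shift addr0.
by rewrite /laurent_of_fps -[1 in LHS]/(fpsC 1) -laurentCE.
Qed.

HB.instance Definition _ := GRing.isZmodMorphism.Build {fps R} {laurent R}
  (@laurent_of_fps R) laurent_of_fps_is_zmod_morphism.
HB.instance Definition _ := GRing.isMonoidMorphism.Build {fps R} {laurent R}
  (@laurent_of_fps R) laurent_of_fps_is_monoid_morphism.

(** The sum of bounds on the individual pole orders bounds each of them, so one exponent serves the
    whole family. *)
Lemma laurent_clear_denominators (I : finType) (c : I -> {laurent R}) :
  exists (M : int) (d : I -> {fps R}),
    forall i, laurent_shift M 1 * c i = laurent_of_fps (d i).
Proof.
have /choice[N cN] i : exists N : nat, forall n : int, n < - N%:Z -> c i n = 0.
  have [N cN] := laurent_bounded (c i); exists `|N|%N => n lt_n; apply: cN; lia.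
pose M := \sum_i N i; exists M%:Z.
suff /choice[d dP] i : exists p, laurent_shift M%:Z 1 * c i = laurent_of_fps p.
  by exists d.
have le_NM : (N i <= M)%N by rewrite /M (bigD1 i) //= leq_addr.
apply: laurent_nonneg => n n0; rewrite -[LHS]/(laurent_conv _ _ n).
rewrite (@laurent_convE _ _ _ M%:Z (- (N i)%:Z) 0) ?big_ord0 //; first 1 last.
- exact: cN.
- by lia.
- by move=> j jM; rewrite /= /laurent_shift_coef leNgt jM.
Qed.

End LaurentOfFps.

Lemma laurent_map_of_fps (R S : comNzRingType) (f : {rmorphism R -> S}) p :
  laurent_map f (laurent_of_fps p) = laurent_of_fps (fps_map f p).
Proof. exact: laurent_map_shift. Qed.

Section LaurentField.
Variable E : fieldType.

Lemma fps_invertible (a : {fps E}) : a 0%N != 0 -> exists b, a * b = 1.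
Proof.
move=> a0; pose S n (u : nat -> E) := \sum_(i < n) a i.+1 * u (n - i.+1)%N.
have [||b bP] := @sequence_recursion E 0
    (fun n u x => a 0%N * x + S n u = (n == 0%N)%:R).
- move=> n u; exists ((a 0%N)^-1 * ((n == 0%N)%:R - S n u)).
  by rewrite mulrA mulfV // mul1r subrK.
- move=> n u v x uv <-; congr (_ + _); apply: eq_bigr => i _.
  by rewrite uv // ltn_subrL (leq_ltn_trans _ (ltn_ord i)).
exists (FPS b); apply/fpsP => n; rewrite fps1E -bP fpsME big_ord_recl /=.
by rewrite subn0.
Qed.

Lemma laurent_invertible (a : {laurent E}) : a != 0 -> exists b, b * a = 1.
Proof.
move=> /eqP a0; have [N [p aE]] := laurent_shiftP a.
have [m pm] : exists m, p m != 0.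
  apply: contrapT => /forallNP p0; apply: a0; rewrite aE.
  apply/laurentP => n; rewrite laurent0E /= /laurent_shift_coef.
  by case: ifP => // _; apply/eqP; apply: contra_notT (p0 `|n - N|%N).
have exm : exists m, p m != 0 by exists m.
case: (ex_minnP exm) => {}m {}pm minm {exm}.
pose p' := FPS (fun n => p (m + n)%N).
have aE' : a = laurent_shift (N + m%:Z) p'.
  rewrite aE; apply/laurentP => n /=; rewrite /laurent_shift_coef.
  case: (leP (N + m%:Z) n) => [le_n|lt_n].
    by rewrite ifT; [congr (p _); lia | lia].
  case: ifP => // le_n; apply/eqP; apply: contraTT isT => /minm; lia.
have [|b p'b] := @fps_invertible p'; first by rewrite /= addn0.
exists (laurent_shift (- (N + m%:Z)) b).
rewrite aE' laurent_mul_shift addNr mulrC p'b.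
exact: rmorph1 (@laurent_of_fps E).
Qed.

(* The field structure is put on an alias: a second path to the ring structure
   of {laurent E} itself makes unification very slow. *)
Definition laurent_field : Type := {laurent E}.
HB.instance Definition _ := GRing.ComNzRing.copy laurent_field {laurent E}.

Definition laurent_inv (a : laurent_field) : laurent_field :=
  if pselect (exists b, b * a = 1) is left ex then sval (cid ex) else 0.

Fact laurent_mulVf a : a != 0 -> laurent_inv a * a = 1.
Proof.
move=> /laurent_invertible ex; rewrite /laurent_inv.
by case: pselect => // {}ex; case: cid.
Qed.

Fact laurent_invr0 : laurent_inv 0 = 0.
Proof.
rewrite /laurent_inv; case: pselect => // ex; exfalso.
by have [b /esym/eqP] := ex; rewrite mulr0 oner_eq0.
Qed.

HB.instance Definition _ :=
  GRing.ComNzRing_isField.Build laurent_field laurent_mulVf laurent_invr0.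

End LaurentField.

(** * Hensel's lemma *)

Section FpsOfPoly.
Variable R : comNzRingType.
Implicit Types (g h : {poly {fps R}}) (a : {fps {poly R}}).

Lemma fps_of_polyE g n i : (fps_of_poly g n)`_i = g`_i n.
Proof. by rewrite /= coef_map_id0 // fps0E. Qed.

Lemma fps_of_poly_inj : injective (@fps_of_poly R).
Proof.
by move=> g h gh; apply/polyP => i; apply/fpsP => n; rewrite -!fps_of_polyE gh.
Qed.

Lemma fps_of_polyM g h : fps_of_poly (g * h) = fps_of_poly g * fps_of_poly h.
Proof.
apply/fpsP => n; apply/polyP => j; rewrite fps_of_polyE coefM fps_sumE.
rewrite fpsME coef_sum; under eq_bigr => i _ do rewrite fpsME.
rewrite exchange_big; apply: eq_bigr => m _; rewrite coefM.
by apply: eq_bigr => i _; rewrite !fps_of_polyE.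
Qed.

Lemma fps_of_poly_surj k a : (forall n, (size (a n) <= k)%N) ->
  exists2 h : {poly {fps R}}, (size h <= k)%N & fps_of_poly h = a.
Proof.
move=> ak; exists (\poly_(i < k) FPS (fun n => (a n)`_i)).
  exact: size_poly.
apply/fpsP => n; apply/polyP => i; rewrite fps_of_polyE coef_poly.
by case: ltnP => // ki; rewrite fps0E nth_default // (leq_trans (ak n)).
Qed.

(** The degree drop in positive powers of t makes the top coefficient the constant series 1. This
    reassembles factors that are built one power of t at a time. *)
Lemma fps_of_poly_monic a : a 0%N \is monic ->
    (forall n, (0 < n)%N -> (size (a n) < size (a 0%N))%N) ->
  exists h : {poly {fps R}},
    [/\ h \is monic, size h = size (a 0%N) & fps_of_poly h = a].
Proof.
move=> a0 an; have [[|n]|h le_h ha] := @fps_of_poly_surj (size (a 0%N)) a.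
- by [].
- by rewrite ltnW // an.
have hE i n : h`_i n = (a n)`_i by rewrite -ha fps_of_polyE.
have size_h : size h = size (a 0%N).
  apply/eqP; rewrite eqn_leq le_h leqNgt; apply/negP => lt_h.
  have := monicP a0; rewrite lead_coefE -hE nth_default.
    by move/eqP; rewrite fps0E eq_sym oner_eq0.
  by rewrite -ltnS prednK // (leq_trans _ lt_h).
exists h; split=> //; apply/monicP/fpsP => n.
rewrite lead_coefE size_h hE fps1E; case: n => [|n].
  by rewrite -lead_coefE (monicP a0).
by rewrite nth_default // -ltnS prednK ?an // (leq_trans _ (an n.+1 isT)).
Qed.

End FpsOfPoly.

Definition fps_coef0 (R : comNzRingType) (a : {fps R}) : R := a 0%N.

Fact fps_coef0_is_zmod_morphism R : zmod_morphism (@fps_coef0 R).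
Proof. by []. Qed.
Fact fps_coef0_is_monoid_morphism R : monoid_morphism (@fps_coef0 R).
Proof. by split=> // a b; apply: fpsM0E. Qed.
HB.instance Definition _ (R : comNzRingType) :=
  GRing.isZmodMorphism.Build {fps R} R (@fps_coef0 R)
    (@fps_coef0_is_zmod_morphism R).
HB.instance Definition _ (R : comNzRingType) :=
  GRing.isMonoidMorphism.Build {fps R} R (@fps_coef0 R)
    (@fps_coef0_is_monoid_morphism R).

Section Hensel.
Variable C : fieldType.

(** Reduce the Bezout cofactor of h modulo g and move the quotient to the other term. The size of
    the second cofactor b is then forced, because g b = e - a h. *)
Lemma coprime_split (g h e : {poly C}) : g \is monic -> h \is monic ->
    coprimep g h -> (size e < (size g + size h).-1)%N ->
  exists ab : {poly C} * {poly C},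
    [/\ (size ab.1 < size g)%N, (size ab.2 < size h)%N
      & g * ab.2 + ab.1 * h = e].
Proof.
move=> mon_g mon_h /Bezout_eq1_coprimepP[[u v] /= uv1] size_e.
have g0 : g != 0 by apply: monic_neq0.
have h0 : h != 0 by apply: monic_neq0.
have gs : (0 < size g)%N by rewrite size_poly_gt0.
have hs : (0 < size h)%N by rewrite size_poly_gt0.
pose a := (e * v) %% g; pose b := e * u + (e * v) %/ g * h.
have size_a : (size a < size g)%N by rewrite ltn_modp.
have abE : g * b + a * h = e.
  transitivity (e * (u * g) + (e * v %/ g * g + a) * h).
    by rewrite /b; ring.
  by rewrite -divp_eq -mulrA -mulrDr uv1 mulr1.
exists (a, b); split=> //=.
have [->|b0] := eqVneq b 0; first by rewrite size_poly0.
have : (size (g * b)%R < (size g + size h).-1)%N.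
  rewrite (canRL (addrK _) abE); apply: leq_ltn_trans (size_polyD _ _) _.
  rewrite gtn_max size_e size_polyN; apply: leq_ltn_trans (size_polyMleq _ _) _.
  clearbody a; move: size_a gs hs; move: (size a) (size g) (size h); lia.
by rewrite size_mul //; move: gs; move: (size b) (size g) (size h); lia.
Qed.

(** In degree n + 1 in t, the equation p = G H reads g H_(n+1) + G_(n+1) h = known terms, which
    [coprime_split] solves. The size bound it asks for holds because p is monic: its higher
    t-coefficients have smaller degree. *)
Lemma hensel_factorization (p : {poly {fps C}}) (g h : {poly C}) :
    p \is monic -> g \is monic -> h \is monic -> coprimep g h ->
    map_poly (@fps_coef0 C) p = g * h ->
  exists G H : {poly {fps C}},
    [/\ G \is monic, H \is monic, p = G * H,
        size G = size g & size H = size h].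
Proof.
move=> mon_p mon_g mon_h co_gh pgh.
have g0 : g != 0 by apply: monic_neq0.
have h0 : h != 0 by apply: monic_neq0.
have gs : (0 < size g)%N by rewrite size_poly_gt0.
have hs : (0 < size h)%N by rewrite size_poly_gt0.
have size_p : size p = (size g + size h).-1.
  rewrite -size_mul // -pgh size_map_poly_id0 //.
  by rewrite (monicP mon_p) rmorph1 oner_neq0.
pose small (x : {poly C} * {poly C}) :=
  (size x.1 < size g)%N /\ (size x.2 < size h)%N.
(* The terms of degree n + 1 in t of G H in which both indices are positive. *)
pose rest n (u : nat -> {poly C} * {poly C}) :=
  \sum_(i < n) (u i.+1).1 * (u (n - i)%N).2.
(* The recursion must be solvable for arbitrary earlier values, so smallness of these is a premise
   of the relation; it is discharged afterwards by induction. *)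
have [||u uP] := @sequence_recursion _ (g, h) (fun n u x =>
    if n is m.+1 then
      (forall i, (i < m)%N -> small (u i.+1)) ->
      small x /\ g * x.2 + x.1 * h + rest m u = fps_of_poly p n
    else x = (g, h)).
- case=> [|n] u; first by exists (g, h).
  have [small_u|] := pselect (forall i, (i < n)%N -> small (u i.+1));
    last by exists (g, h).
  pose e := fps_of_poly p n.+1 - rest n u.
  have [|ab [a_lt b_lt abE]] := @coprime_split g h e mon_g mon_h co_gh.
    have lt_sum (r : {poly C}) :
        (size r < size p)%N = (size r <= (size p).-1)%N.
      rewrite size_p; move: gs hs.
      by move: (size g) (size h) (size r); lia.
    rewrite -size_p lt_sum; apply: leq_trans (size_polyD _ _) _.
    rewrite geq_max size_polyN; apply/andP; split.
      apply/leq_sizeP => j le_j; rewrite fps_of_polyE.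
      move: le_j; rewrite leq_eqVlt => /predU1P[<-|lt_j].
        by rewrite -lead_coefE (monicP mon_p) fps1E.
      by rewrite nth_default ?fps0E // (leq_trans (leqSpred _) lt_j).
    apply: leq_trans (size_sum _ _ _) _; apply/bigmax_leqP => i _.
    apply: leq_trans (size_polyMleq _ _) _.
    have [+ _] := small_u i (ltn_ord i).
    have [|_ +] := small_u (n - i.+1)%N; first by have := ltn_ord i; lia.
    rewrite subnSK // size_p.
    move: (size (u i.+1).1) (size (u (n - i)%N).2) => r s ss rr.
    move: gs hs ss rr; case: (size g) (size h) => [|sg] [|sh] //=; clear; lia.
  by exists ab => _; split=> //; rewrite abE subrK.
- case=> [|n] u v x uv //= Ru small_v.
  have [|? <-] := Ru; first by move=> i lt_in; rewrite uv //; apply: small_v.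
  split=> //; congr (_ + _); apply: eq_bigr => i _.
  by rewrite !uv //; have := ltn_ord i; lia.
have small_u n : small (u n.+1).
  by elim/ltn_ind: n => n IHn; case: (uP n.+1 IHn).
have u0 : u 0%N = (g, h) := uP 0%N.
have [||G [mon_G sG GE]] := @fps_of_poly_monic C (FPS (fun n => (u n).1)).
- by rewrite /= u0.
- by case=> // n _; rewrite /= u0; case: (small_u n).
have [||H [mon_H sH HE]] := @fps_of_poly_monic C (FPS (fun n => (u n).2)).
- by rewrite /= u0.
- by case=> // n _; rewrite /= u0; case: (small_u n).
exists G, H; split=> //; first 1 last.
- by rewrite sG /= u0.
- by rewrite sH /= u0.
apply: fps_of_poly_inj; rewrite fps_of_polyM GE HE; apply/fpsP => -[|n].
  by rewrite fpsM0E /= u0 /= -pgh; apply: eq_map_poly.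
rewrite fpsME big_ord_recl big_ord_recr /= subn0 subnn u0 /=.
have [_ pE] := uP n.+1 (fun i _ => small_u i).
rewrite -[LHS]/(fps_of_poly p n.+1) -pE -addrA; congr (_ + _).
by rewrite addrC.
Qed.

End Hensel.

(** * Puiseux's theorem *)

Section LinearFactors.
Variable R : comNzRingType.

Lemma coef_pred_XsubC_exp (c : R) n : (('X - c%:P) ^+ n.+1)`_n = - c *+ n.+1.
Proof.
elim: n => [|n IHn]; first by rewrite expr1 coefB coefX coefC sub0r.
rewrite exprS mulrBl coefB coefXM coefCM /= IHn.
have := monicP (monic_exp n.+1 (monicXsubC c)).
rewrite lead_coefE size_exp_XsubC /= => ->.
by rewrite mulr1 [RHS]mulrS addrC.
Qed.

(** Up to sign the coefficient is the elementary symmetric function of degree [size rs - i], which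
    is homogeneous. No division by u occurs: u will be a power of the variable. *)
Lemma prod_XsubC_scale (u : R) (rs : seq R) i :
  (\prod_(r <- rs) ('X - (u * r)%:P))`_i =
  (\prod_(r <- rs) ('X - r%:P))`_i * u ^+ (size rs - i).
Proof.
elim: rs i => [|r rs IHrs] i.
  by rewrite !big_nil coef1; case: i => [|i]; rewrite ?mulr1 ?mul0r.
rewrite !big_cons !mulrBl !coefB !coefXM !coefCM !IHrs /=.
set P := \prod_(s <- rs) _; case: i => [|i] /=.
  by rewrite !sub0r !subn0 exprS; ring.
rewrite subSS; case: (ltnP i (size rs)) => [lt_i|le_i].
  by rewrite -(subnSK lt_i) exprS; ring.
by rewrite [P`_i.+1]nth_default ?size_prod_XsubC //; ring.
Qed.

Lemma monic_comp_XsubC (p : {poly R}) c : p \is monic ->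
  p \Po ('X - c%:P) \is monic /\ size (p \Po ('X - c%:P)) = size p.
Proof.
move=> mon_p; case size_p: (size p) => [|n].
  by have := monic_neq0 mon_p; rewrite -size_poly_eq0 size_p.
set P := p \Po _; have le_P : (size P <= n.+1)%N.
  apply: leq_trans (size_comp_poly_leq _ _) _.
  by rewrite size_p size_XsubC muln1.
have Pn : P`_n = 1.
  rewrite /P comp_polyE size_p coef_sum big_ord_recr big1 => [|i _]; last first.
    rewrite coefZ [X in _ * X]nth_default ?mulr0 //.
    rewrite size_exp_XsubC; exact: (ltn_ord i).
  have := monicP mon_p; rewrite lead_coefE size_p /= => ->.
  have := monicP (monic_exp n (monicXsubC c)).
  by rewrite lead_coefE size_exp_XsubC add0r scale1r.
have size_P : size P = n.+1.
  apply/eqP; rewrite eqn_leq le_P ltnNge; apply/negP => /(nth_default 0)/eqP.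
  by rewrite Pn oner_eq0.
by split=> //; apply/monicP; rewrite lead_coefE size_P.
Qed.

Lemma coef_comp_XaddC_top (p : {poly R}) c n : (size p <= n.+1)%N ->
  (p \Po ('X + c%:P))`_n = p`_n.
Proof.
move=> le_p; rewrite coef_comp_poly.
rewrite (big_ord_widen n.+1 (fun i => p`_i * (('X + c%:P) ^+ i)`_n)) //.
rewrite -[X in 'X + X]opprK -polyCN big_mkcond big_ord_recr /= big1 => [|i _].
  have := monicP (monic_exp n (monicXsubC (- c))).
  rewrite lead_coefE size_exp_XsubC add0r => /= ->.
  by case: ltnP => [_|le_n]; rewrite ?mulr1 // nth_default.
rewrite [X in _ * X]nth_default ?mulr0 ?if_same // size_exp_XsubC.
exact: (ltn_ord i).
Qed.

(** Just below the top, translation adds only a first-derivative term. This term removes the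
    subleading coefficient in Puiseux's theorem and governs how T - 1 and y - q^a act on powers of
    log_q x. *)
Lemma coef_comp_XaddC_pred (p : {poly R}) c n : (size p <= n.+2)%N ->
  (p \Po ('X + c%:P))`_n = p`_n + c * p`_n.+1 *+ n.+1.
Proof.
move=> le_p; have -> : p = \poly_(i < n.+1) p`_i + p`_n.+1 *: 'X^(n.+1).
  apply/polyP => i; rewrite coefD coef_poly coefZ coefXn.
  case: (ltngtP i n.+1) => [_|lt_i|->]; rewrite ?mulr0 ?mulr1 ?addr0 ?add0r //.
  by rewrite nth_default // (leq_trans le_p).
rewrite comp_polyD comp_polyZ comp_Xn_poly !coefD.
rewrite coef_comp_XaddC_top ?size_poly //.
rewrite -[X in 'X + X]opprK -polyCN !coefZ coef_pred_XsubC_exp opprK !coefXn.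
rewrite !coef_poly ltnSn ltnn eqxx (ltn_eqF (ltnSn n)) /=.
by rewrite mulr0 mulr1 addr0 add0r mulrnAr mulrC.
Qed.

End LinearFactors.

Section PuiseuxSplit.
Variable R : comNzRingType.

Definition fpsX : {fps R} := FPS (fun n => (n == 1%N)%:R).

Lemma fpsXM (a : {fps R}) n : (fpsX * a) n = if n is m.+1 then a m else 0.
Proof.
case: n => [|n]; first by rewrite fpsM0E mul0r.
rewrite fpsME big_ord_recl big_ord_recl big1 => [|i _]; last by rewrite mul0r.
by rewrite /= mul0r mul1r add0r addr0 subSS subn0.
Qed.

Lemma fps_divXn e (a : {fps R}) : (forall m, (m < e)%N -> a m = 0) ->
  a = fpsX ^+ e * FPS (fun m => a (m + e)%N).
Proof.
elim: e => [|e IHe] in a * => a0.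
  by rewrite mul1r; apply/fpsP => n /=; rewrite addn0.
rewrite exprS -mulrA; apply/fpsP => -[|n]; rewrite fpsXM; first exact: a0.
have -> : FPS (fun m => a (m + e.+1)%N) =
    FPS (fun m => FPS (fun m => a m.+1) (m + e)%N).
  by apply/fpsP => m /=; rewrite addnS.
by rewrite -(IHe (FPS (fun m => a m.+1))) // => m lt_me; apply: a0.
Qed.

Definition puiseux_split (p : {poly {fps R}}) :=
  exists (L : nat) (rs : seq {fps R}),
    map_poly (fps_ramify L.+1) p = \prod_(r <- rs) ('X - r%:P).

Lemma map_ramify_prod_XsubC L (rs : seq {fps R}) :
  map_poly (fps_ramify L.+1) (\prod_(r <- rs) ('X - r%:P)) =
  \prod_(r <- map (fps_ramify L.+1) rs) ('X - r%:P).
Proof.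
rewrite rmorph_prod big_map; apply: eq_bigr => r _.
by rewrite rmorphB /= map_polyX map_polyC.
Qed.

Lemma map_ramifyM L M (p : {poly {fps R}}) :
  map_poly (fps_ramify L.+1) (map_poly (fps_ramify M.+1) p) =
  map_poly (fps_ramify (M.+1 * L.+1)) p.
Proof.
by rewrite -map_poly_comp; apply: eq_map_poly => a; apply: fps_ramifyM.
Qed.

Lemma puiseux_split_ramify M p :
  puiseux_split (map_poly (fps_ramify M.+1) p) -> puiseux_split p.
Proof.
move=> [L [rs]]; rewrite map_ramifyM => pE.
by exists (M.+1 * L.+1).-1, rs; rewrite prednK.
Qed.

(** The two ramifications are reconciled by applying both; they commute. *)
Lemma puiseux_splitM p r :
  puiseux_split p -> puiseux_split r -> puiseux_split (p * r).
Proof.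
move=> [L [rs pE]] [M [ss rE]]; apply: (@puiseux_split_ramify L).
exists M, (map (fps_ramify M.+1) rs ++ map (fps_ramify L.+1) ss).
rewrite !rmorphM /= pE map_ramify_prod_XsubC big_cat; congr (_ * _).
by rewrite map_ramifyM mulnC -map_ramifyM rE map_ramify_prod_XsubC.
Qed.

Lemma puiseux_split_translate p c :
  puiseux_split (p \Po ('X - c%:P)) -> puiseux_split p.
Proof.
move=> [L [rs]]; rewrite map_comp_poly rmorphB /= map_polyX map_polyC /=.
set u := fps_ramify L.+1 c => pE; exists L, (map (fun r => r - u) rs).
set P := map_poly _ p in pE *.
have -> : P = (P \Po ('X - u%:P)) \Po ('X + u%:P).
  by have := comp_polyXaddC_K P (- u); rewrite polyCN opprK.
rewrite pE rmorph_prod big_map; apply: eq_bigr => r _.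
by rewrite raddfB /= comp_polyX comp_polyC polyCB opprB addrA.
Qed.

(** This is the substitution X = u Y: the roots of p are u times those of b. *)
Lemma puiseux_split_scale (u : {fps R}) n p b :
    p \is monic -> b \is monic -> size p = n.+1 -> size b = n.+1 ->
    (forall i, (i < n)%N -> p`_i = b`_i * u ^+ (n - i)) ->
  puiseux_split b -> puiseux_split p.
Proof.
move=> mon_p mon_b size_p size_b pb [L [rs bE]].
have size_rs : size rs = n.
  apply: succn_inj; rewrite -(size_prod_XsubC rs id) -bE.
  by rewrite size_map_poly_id0 // (monicP mon_b) rmorph1 oner_neq0.
exists L, (map ( *%R (fps_ramify L.+1 u)) rs).
apply/polyP => i; rewrite big_map /= prod_XsubC_scale -bE size_rs !coef_map.
rewrite -rmorphXn -rmorphM; congr (fps_ramify _ _).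
case: (ltngtP i n) => [/pb//|lt_ni|->].
  by rewrite !nth_default ?mul0r ?size_p ?size_b.
have := (monicP mon_p, monicP mon_b); rewrite !lead_coefE size_p size_b /=.
by case=> -> ->; rewrite subnn mulr1.
Qed.

End PuiseuxSplit.

Section Puiseux.
Variable C : closedFieldType.
Hypothesis charC : forall n, n.+1%:R != 0 :> C.

Lemma fps_valuation (a : {fps C}) :
  exists v, a != 0 -> a v != 0 /\ forall m, (m < v)%N -> a m = 0.
Proof.
have [->|/eqP a0] := eqVneq a 0; first by exists 0%N.
have exv : exists v, a v != 0.
  apply: contrapT => /forallNP av; apply: a0; apply/fpsP => n; rewrite fps0E.
  by apply/eqP; apply: contra_notT (av n).
case: (ex_minnP exv) => v av minv; exists v => _; split=> // m lt_mv.
by apply/eqP; apply: contraTT lt_mv => /minv; rewrite leqNgt.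
Qed.

(** Split off one root c with its full multiplicity. Were the cofactor constant, b would be (X -
    c)^(n+1), with subleading coefficient -(n+1) c; this vanishes only for c = 0, and then b is the
    excluded power of X. *)
Lemma non_pure_power_split (b : {poly C}) n : b \is monic -> size b = n.+2 ->
    b`_n = 0 -> b != 'X^(n.+1) ->
  exists g h : {poly C},
    [/\ g \is monic /\ h \is monic, coprimep g h, b = g * h,
        (size g < n.+2)%N & (size h < n.+2)%N].
Proof.
move=> mon_b size_b bn0 bX.
have [c rc] : exists c, root b c by apply/closed_rootP; rewrite size_b.
have [e [w /implyP wc bE]] := multiplicity_XsubC b c.
have {}wc : ~~ root w c by apply: wc; apply: monic_neq0.
have mon_e : ('X - c%:P) ^+ e \is monic by apply/monic_exp/monicXsubC.
have mon_w : w \is monic by rewrite -(monicMr _ mon_e) -bE.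
have w0 := monic_neq0 mon_w.
have e0 : (0 < e)%N.
  by case: e bE {mon_e} => // bE; rewrite bE mulr1 (negPf wc) in rc.
have size_we : n.+2 = (size w + e)%N.
  by rewrite -size_b bE size_Mmonic // size_exp_XsubC addnS.
have size_w1 : (1 < size w)%N.
  rewrite ltn_neqAle size_poly_gt0 w0 andbT eq_sym.
  apply: contra bX => /size_poly1P[a _ wa].
  have w1 : w = 1 by have := monicP mon_w; rewrite wa lead_coefC => ->.
  have en : e = n.+1 by move: size_we; rewrite w1 size_poly1 add1n => -[].
  move: bn0; rewrite bE w1 mul1r en coef_pred_XsubC_exp => /eqP.
  rewrite mulNrn oppr_eq0 -mulr_natr mulf_eq0 (negPf (charC n)) orbF.
  by move/eqP->; rewrite subr0.
exists (('X - c%:P) ^+ e), w; split=> //.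
- by rewrite coprimep_expl // coprimep_sym coprimep_XsubC.
- by rewrite mulrC.
- by rewrite size_exp_XsubC; lia.
- by rewrite size_we -addn1 leq_add2l.
Qed.

(* Newton polygon: r / n.+1! is its smallest slope, so t = s^(n.+1!) and
   X = s^r Y turn p into s^(r n.+1) b(Y), where b mod s is not Y^(n.+1) and,
   its subleading coefficient being 0, not (Y - c)^(n.+1) either. *)
Lemma puiseux_depressed n (p : {poly {fps C}}) :
    p \is monic -> size p = n.+2 -> p`_n = 0 ->
    (forall r : {poly {fps C}},
       r \is monic -> (size r < n.+2)%N -> puiseux_split r) ->
  puiseux_split p.
Proof.
move=> mon_p size_p pn0 IH; have [v vP] := choice fps_valuation.
have [[i0 pi0]|p0] := pselect (exists i : 'I_n.+1, p`_i != 0); last first.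
  exists 0%N, (nseq n.+1 0); rewrite big_nseq iter_mulr_1 subr0.
  have -> : p = 'X^(n.+1).
    apply/polyP => i; rewrite coefXn; case: (ltngtP i n.+1) => [lt_i|lt_i|->].
    - by apply/eqP; apply: contra_notT p0 => pi; exists (Ordinal lt_i).
    - by rewrite nth_default // size_p.
    - by have := monicP mon_p; rewrite lead_coefE size_p.
  by rewrite rmorphXn /= map_polyX.
have fact_dvd (i : 'I_n.+1) :
    ((n.+1)`! %/ (n.+1 - i) * (n.+1 - i) = (n.+1)`!)%N.
  by apply: divnK; apply: dvdn_fact; rewrite subn_gt0 ltn_ord leq_subr.
pose slope (i : 'I_n.+1) := (v (p`_i)%R * ((n.+1)`! %/ (n.+1 - i)))%N.
have [i1 pi1 min_i1] :=
  @arg_minnP _ i0 (fun i : 'I_n.+1 => p`_i != 0) slope pi0.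
set r := slope i1 in min_i1.
have [L LE] : exists L, ((n.+1)`!)%N = L.+1.
  by exists ((n.+1)`!).-1%N; rewrite prednK ?fact_gt0.
have slopeM (i : 'I_n.+1) : (slope i * (n.+1 - i) = v (p`_i)%R * L.+1)%N.
  by rewrite -LE -(fact_dvd i) mulnA.
pose c i := FPS (fun m => fps_ramify L.+1 p`_i (m + r * (n.+1 - i))%N).
have cE i : (i < n.+1)%N ->
    fps_ramify L.+1 p`_i = c i * (fpsX C ^+ r) ^+ (n.+1 - i).
  move=> lt_i; rewrite -exprM mulrC; apply: fps_divXn => m lt_m /=.
  case: ifP => // /dvdnP[m' mE]; rewrite mE mulnK //.
  have [->|pi] := eqVneq p`_i 0; first by rewrite fps0E.
  have [_ -> //] := vP _ pi; rewrite -(ltn_pmul2r (ltn0Sn L)) -mE.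
  apply: leq_trans lt_m _; rewrite -(slopeM (Ordinal lt_i)) leq_mul2r.
  by rewrite (min_i1 (Ordinal lt_i)) ?orbT.
pose b : {poly {fps C}} := 'X^(n.+1) + \poly_(i < n.+1) c i.
have size_b : size b = n.+2.
  by rewrite size_polyDl size_polyXn // ltnS size_poly.
have mon_b : b \is monic.
  apply/monicP; rewrite lead_coefDl ?lead_coefXn //.
  by rewrite size_polyXn ltnS size_poly.
have bE i : (i < n.+1)%N -> b`_i = c i.
  by move=> lt_i; rewrite coefD coefXn coef_poly lt_i (ltn_eqF lt_i) add0r.
apply: (@puiseux_split_ramify _ L).
apply: (@puiseux_split_scale _ (fpsX C ^+ r) n.+1 _ b).
- exact: monic_map.
- exact: mon_b.
- by rewrite size_map_poly_id0 // (monicP mon_p) rmorph1 oner_neq0.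
- exact: size_b.
- by move=> i lt_i; rewrite coef_map bE //; apply: cE.
have [|||g [h [[mon_g mon_h] co_gh bgh size_g size_h]]] :=
    @non_pure_power_split (map_poly (@fps_coef0 C) b) n (monic_map _ mon_b).
- by rewrite size_map_poly_id0 // (monicP mon_b) rmorph1 oner_neq0.
- by rewrite coef_map bE // /fps_coef0 /c /= pn0 fps0E if_same.
(* At [i1], where the slope is minimal, the constant term of [c i1] is the first nonzero coefficient
   of the series at index [i1] in p. *)
- apply/eqP => /(congr1 (fun s : {poly C} => s`_i1)) /eqP.
  rewrite coefXn (ltn_eqF (ltn_ord i1)) coef_map bE // /fps_coef0 /c /=.
  have [pv _] := vP _ pi1.
  by rewrite add0n slopeM dvdn_mull // mulnK // (negPf pv).
have [G [H [mon_G mon_H -> size_G size_H]]] :=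
  hensel_factorization mon_b mon_g mon_h co_gh bgh.
by apply: puiseux_splitM; apply: IH; rewrite ?size_G ?size_H.
Qed.

Theorem puiseux (p : {poly {fps C}}) : p \is monic -> puiseux_split p.
Proof.
have [N] := ubnP (size p); elim: N => // N IHN in p *.
rewrite ltnS => le_p mon_p.
have IH (r : {poly {fps C}}) :
    r \is monic -> (size r < size p)%N -> puiseux_split r.
  by move=> mon_r lt_r; apply: IHN => //; apply: leq_trans le_p.
case size_p: (size p) => [|[|n]].
- by have := monic_neq0 mon_p; rewrite -size_poly_eq0 size_p.
- have /eqP/size_poly1P[a _ pa] := size_p.
  have -> : p = 1 by have := monicP mon_p; rewrite pa lead_coefC => ->.
  by exists 0%N, [::]; rewrite big_nil rmorph1.
(* Replacing X by X - c subtracts (n+1) c from the subleading coefficient, which therefore becomes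
   0. *)
pose c : {fps C} := FPS (fun m => p`_n m / n.+1%:R).
have cE : c *+ n.+1 = p`_n.
  by apply/fpsP => m; rewrite fps_natE /= -[LHS]mulr_natr divfK.
apply: (@puiseux_split_translate _ _ c); apply: (@puiseux_depressed n).
- by have [] := monic_comp_XsubC c mon_p.
- by have [_ ->] := monic_comp_XsubC c mon_p.
- rewrite -polyCN coef_comp_XaddC_pred ?size_p //.
  have := monicP mon_p; rewrite lead_coefE size_p /= => ->.
  by rewrite mulr1 mulNrn cE subrr.
- by move=> r mon_r lt_r; apply: IH => //; rewrite size_p.
Qed.

End Puiseux.

(** * Lifting along powers of t *)

Lemma triangle_exchange (V : nmodType) (G : nat -> nat -> V) n :
  \sum_(i < n.+1) \sum_(j < (n - i).+1) G i j =
  \sum_(j < n.+1) \sum_(i < (n - j).+1) G i j.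
Proof.
pose H i j := if (i + j <= n)%N then G i j else 0.
have row (K : nat -> nat -> V) (i : 'I_n.+1) :
    \sum_(j < (n - i).+1) K i j =
    \sum_(j < n.+1) (if (i + j <= n)%N then K i j else 0).
  rewrite (big_ord_widen n.+1 (K i)) ?ltnS ?leq_subr // big_mkcond.
  by apply: eq_bigr => j _; rewrite ltnS leq_subRL // -ltnS.
rewrite (eq_bigr _ (fun i _ => row G i)) exchange_big; apply: eq_bigr => j _ /=.
by rewrite (row (fun j i => G i j)); apply: eq_bigr => i _; rewrite addnC.
Qed.

Section SemilinearOperators.
Variables (K W : comNzRingType) (s : {rmorphism K -> W}).

(** K-linearity, with K acting on the ring W through s. *)
Definition slinear (A : W -> W) :=
  forall c x y, A (s c * x + y) = s c * A x + A y.

Lemma slinear0 A : slinear A -> A 0 = 0.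
Proof.
move=> lA; have := lA 1 0 0; rewrite rmorph1 !mul1r addr0 => /eqP.
by rewrite -subr_eq subrr eq_sym => /eqP.
Qed.

Lemma slinearD A x y : slinear A -> A (x + y) = A x + A y.
Proof. by move=> lA; have := lA 1 x y; rewrite rmorph1 !mul1r. Qed.

Lemma slinearZ A c x : slinear A -> A (s c * x) = s c * A x.
Proof. by move=> lA; have := lA c x 0; rewrite (slinear0 lA) !addr0. Qed.

Lemma slinearN A x : slinear A -> A (- x) = - A x.
Proof. by move=> lA; have := slinearZ (-1) x lA; rewrite rmorphN1 !mulN1r. Qed.

Lemma slinear_sum A (I : Type) (r : seq I) (P : pred I) F : slinear A ->
  A (\sum_(i <- r | P i) F i) = \sum_(i <- r | P i) A (F i).
Proof.
move=> lA; elim/big_rec2: _ => [|i y x _ <-]; first exact: slinear0.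
exact: slinearD.
Qed.

End SemilinearOperators.

(* R 0 + R 1 t + R 2 t^2 + ... is an operator on W[[t]], semilinear over s. *)
Section Lifting.
Variables (K W : comNzRingType) (s : {rmorphism K -> W}) (R : nat -> W -> W).
Hypothesis R_linear : forall n, slinear s (R n).

Definition in_fps_kernel (f : {fps W}) :=
  forall n, \sum_(i < n.+1) R i (f (n - i)%N) = 0.

Lemma in_fps_kernel0 : in_fps_kernel 0.
Proof.
move=> n; apply: big1 => i _.
by rewrite fps0E (slinear0 (@R_linear i)).
Qed.

Lemma in_fps_kernelD f g :
  in_fps_kernel f -> in_fps_kernel g -> in_fps_kernel (f + g).
Proof.
move=> kf kg n.
under eq_bigr => i _ do rewrite fpsDE (slinearD _ _ (@R_linear i)).
by rewrite big_split /= kf kg addr0.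
Qed.

Lemma in_fps_kernelZ c f : in_fps_kernel f -> in_fps_kernel (fps_map s c * f).
Proof.
move=> kf n.
pose G i j := s (c j) * R i (f (n - i - j)%N).
transitivity (\sum_(i < n.+1) \sum_(j < (n - i).+1) G i j).
  apply: eq_bigr => i _; rewrite fpsME (slinear_sum _ _ _ (@R_linear i)).
  by apply: eq_bigr => j _; rewrite (slinearZ _ _ (@R_linear i)).
rewrite triangle_exchange big1 // => j _.
rewrite -[RHS](mulr0 (s (c j))) -[in RHS](kf (n - j)%N) mulr_sumr.
by apply: eq_bigr => i _; rewrite /G -!subnDA addnC.
Qed.

Lemma in_fps_kernel_sum (I : Type) (r : seq I) (P : pred I) F :
    (forall i, P i -> in_fps_kernel (F i)) ->
  in_fps_kernel (\sum_(i <- r | P i) F i).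
Proof.
move=> kF; elim/big_rec: _ => [|i g Pi kg]; first exact: in_fps_kernel0.
by apply: in_fps_kernelD => //; apply: kF.
Qed.

(** The coefficient of t^(n+1) in the equation prescribes [R 0] of the next unknown in terms of the
    earlier ones; surjectivity solves it. *)
Lemma fps_kernel_lift w : (forall y, exists x, R 0%N x = y) -> R 0%N w = 0 ->
  exists2 f, in_fps_kernel f & f 0%N = w.
Proof.
move=> R0_surj R0w.
have [||f fP] := @sequence_recursion W 0 (fun n u x =>
    if n is m.+1 then R 0%N x + \sum_(i < n) R i.+1 (u (m - i)%N) = 0
    else x = w).
- case=> [|n] u; first by exists w.
  have [x xE] := R0_surj (- \sum_(i < n.+1) R i.+1 (u (n - i)%N)).
  by exists x; rewrite xE addNr.
- case=> [|n] u v x uv // uE; rewrite -[RHS]uE; congr (_ + _).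
  apply: eq_bigr => i _.
  by rewrite uv // ltnS leq_subr.
exists (FPS f); last exact: fP 0%N.
case=> [|n]; first by rewrite big_ord1 /= (fP 0%N).
have fE : R 0%N (f n.+1) + \sum_(i < n.+1) R i.+1 (f (n - i)%N) = 0 := fP n.+1.
by rewrite big_ord_recl -[RHS]fE.
Qed.

Variables (k : nat) (g : 'I_k -> {fps W}).
Hypothesis g_kernel : forall i, in_fps_kernel (g i).

(** Division by t, repeated: subtract the combination of the [g i] that matches the constant term;
    the rest is t times another kernel element. [nxt] returns the digits and this quotient, and the
    digits of the successive quotients [F n] are the coefficients of the series [c i]. *)
Lemma fps_kernel_span :
    (forall w, R 0%N w = 0 ->
       exists c : 'I_k -> K, w = \sum_i s (c i) * g i 0%N) ->
  forall f, in_fps_kernel f ->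
    exists c : 'I_k -> {fps K}, f = \sum_i fps_map s (c i) * g i.
Proof.
move=> span0 f kf.
have /choice[nxt nxtP] (h : {fps W}) : exists cf : ('I_k -> K) * {fps W},
    in_fps_kernel h -> [/\ in_fps_kernel cf.2,
      h 0%N = \sum_i s (cf.1 i) * g i 0%N &
      forall m, h m.+1 = \sum_i s (cf.1 i) * g i m.+1 + cf.2 m].
  have [kh|] := pselect (in_fps_kernel h); last by exists (fun=> 0, 0).
  have [|c c0] := span0 (h 0%N); first by have := kh 0%N; rewrite big_ord1.
  pose d := h - \sum_i fps_map s (fpsC (c i)) * g i.
  have dE m : d m = h m - \sum_i s (c i) * g i m.
    rewrite fpsDE fpsNE fps_sumE; congr (_ - _); apply: eq_bigr => i _.
    rewrite -fpsCM; congr (fps_coef (_ * _) _).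
    by apply/fpsP => -[|j] //=; rewrite rmorph0.
  have kd : in_fps_kernel d.
    rewrite /d -mulN1r -(rmorphN1 (fps_map s)); apply: in_fps_kernelD => //.
    apply: in_fps_kernelZ; apply: in_fps_kernel_sum => i _.
    exact: in_fps_kernelZ.
  exists (c, FPS (fun m => d m.+1)) => _; split=> // [n|m].
    have d0 : d (n.+1 - @ord_max n.+1)%N = 0 by rewrite subnn dE -c0 subrr.
    have := kd n.+1; rewrite big_ord_recr d0.
    rewrite (slinear0 (@R_linear _)) => dk; rewrite -[RHS]dk -[LHS]addr0.
    congr (_ + _).
    apply: eq_bigr => i _.
    transitivity (R i (d (n - i).+1)) => //.
    by rewrite -subSn // -ltnS.
  by rewrite -[X in _ + X]/(d m.+1) dE addrC subrK.
pose F n := iter n (fun h => (nxt h).2) f.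
have kF n : in_fps_kernel (F n) by elim: n => //= n /nxtP[].
pose c i := FPS (fun n => (nxt (F n)).1 i).
have FE m n : F n m = \sum_i \sum_(j < m.+1) s (c i (n + j)%N) * g i (m - j)%N.
  elim: m n => [|m IHm] n; have [_ F0 FS] := nxtP _ (kF n).
    by rewrite F0; apply: eq_bigr => i _; rewrite big_ord1 addn0.
  rewrite FS -[(nxt (F n)).2]/(F n.+1) IHm -big_split; apply: eq_bigr => i _.
  rewrite [RHS]big_ord_recl addn0 subn0; congr (_ + _).
  by apply: eq_bigr => j _; rewrite addSnnS subSS.
exists c; apply/fpsP => m; rewrite fps_sumE -[f]/(F 0%N) FE.
by apply: eq_bigr => i _; rewrite fpsME.
Qed.

End Lifting.

(** Once all digits below n vanish, coefficient n of the relation is a relation between the constant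
    terms. *)
Lemma fps_free_lift (K W : comNzRingType) (s : {rmorphism K -> W}) k
    (g : 'I_k -> {fps W}) :
    (forall c : 'I_k -> K, \sum_i s (c i) * g i 0%N = 0 -> forall i, c i = 0) ->
  forall c : 'I_k -> {fps K}, \sum_i fps_map s (c i) * g i = 0 ->
    forall i, c i = 0.
Proof.
move=> free0 c cg0 i; apply/fpsP => n; rewrite fps0E.
elim/ltn_ind: n i => n IHn; apply: free0.
have /fpsP/(_ n) := cg0; rewrite fps0E fps_sumE => cgn; rewrite -[RHS]cgn.
apply: eq_bigr => i _.
rewrite fpsME big_ord_recr big1 /= ?add0r ?subnn // => j _.
by rewrite IHn // rmorph0 mul0r.
Qed.

(** * q-difference operators *)

Lemma laurent_natE (R : comNzRingType) (a : {laurent R}) m n :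
  (a *+ m) n = a n *+ m.
Proof.
by elim: m => [|m IHm]; rewrite ?mulr0n ?laurent0E // !mulrS laurentDE IHm.
Qed.

Lemma laurentCM (R : comNzRingType) (c : R) (a : {laurent R}) n :
  (laurentC c * a) n = c * a n.
Proof.
have [N [p ->]] := laurent_shiftP a; rewrite laurentCE laurent_mul_shift add0r.
by rewrite /= /laurent_shift_coef; case: ifP; rewrite ?mulr0 // -fpsCM.
Qed.

Lemma map_poly_XaddC1 (R S : comNzRingType) (f : {rmorphism R -> S}) :
  map_poly f ('X + 1%:P) = 'X + 1%:P.
Proof. by rewrite polyC1 rmorphD rmorph1 /= map_polyX. Qed.

Section QShift.
Variables (E : fieldType) (q : E).

Fact qshift_laurent_is_zmod_morphism j : zmod_morphism (qshift_laurent q j).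
Proof. by move=> a b; apply/laurentP => n /=; rewrite mulrBr. Qed.
HB.instance Definition _ j :=
  GRing.isZmodMorphism.Build {laurent E} {laurent E} (qshift_laurent q j)
    (qshift_laurent_is_zmod_morphism j).

Hypothesis q0 : q != 0.

Fact qshift_laurent_is_monoid_morphism j : monoid_morphism (qshift_laurent q j).
Proof.
have shiftE N p : qshift_laurent q j (laurent_shift N p) =
    laurent_shift N (FPS (fun n => q ^ (j * (N + n%:Z)) * p n)).
  apply/laurentP => n; rewrite /= /laurent_shift_coef.
  case: ifP => [Nn|_]; last by rewrite mulr0.
  by congr (q ^ (j * _) * _); lia.
split=> [|a b].
  apply/laurentP => n /=; case: eqP => [->|]; last by rewrite mulr0.
  by rewrite mulr0 mul1r.
have [[M [p ->]] [N [r ->]]] := (laurent_shiftP a, laurent_shiftP b).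
rewrite laurent_mul_shift !shiftE laurent_mul_shift; congr laurent_shift.
apply/fpsP => n /=; rewrite mulr_sumr; apply: eq_bigr => i _.
rewrite mulrACA -expfzDr // -mulrDr; congr (q ^ (j * _) * _).
by have := ltn_ord i; lia.
Qed.

(** Multiplicativity rests on the hypothesis [q0] (for q = 0 and j = 1, both x and x^(-1) would go
    to 0), so the structure is packed explicitly. *)
Definition qshift_laurent_rmorphism j :
    {rmorphism {laurent E} -> {laurent E}} :=
  HB.pack (qshift_laurent q j)
    (GRing.isZmodMorphism.Build _ _ _ (qshift_laurent_is_zmod_morphism j))
    (GRing.isMonoidMorphism.Build _ _ _ (qshift_laurent_is_monoid_morphism j)).

Definition qshift_rmorphism j :
    {rmorphism {poly {laurent E}} -> {poly {laurent E}}} :=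
  comp_poly ('X + j%:~R%:P) \o map_poly (qshift_laurent_rmorphism j).

Lemma qshiftE j : qshift q j = qshift_rmorphism j. Proof. by []. Qed.

Lemma qshift_comp_map j p : qshift q j p =
  map_poly (qshift_laurent_rmorphism j) p \Po ('X + j%:~R%:P).
Proof. by []. Qed.

Lemma qshift_logconst j c : qshift q j (logconst E c) = logconst E c.
Proof.
rewrite -[logconst E c]/((laurentC c)%:P) qshiftE /= map_polyC comp_polyC.
congr (_%:P).
apply/laurentP => n /=; case: eqP => [->|]; last by rewrite mulr0.
by rewrite mulr0 mul1r.
Qed.

Lemma qshift_slinear j : slinear (logconst E) (qshift q j).
Proof.
by move=> c x y; rewrite qshiftE rmorphD rmorphM -qshiftE qshift_logconst.
Qed.

Lemma qdiffop_app_slinear D : slinear (logconst E) (qdiffop_app q D).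
Proof.
move=> c x y; rewrite /qdiffop_app mulr_sumr -big_split; apply: eq_bigr => j _.
by rewrite qshift_slinear scalerDr scalerAr.
Qed.

(** The monodromy operator T, on polynomials in log_q x. *)
Definition log_shift (R : comNzRingType) : {poly R} -> {poly R} :=
  comp_poly ('X + 1%:P).

HB.instance Definition _ (R : comNzRingType) :=
  GRing.RMorphism.copy (@log_shift R) (comp_poly ('X + 1%:P)).

Lemma log_shift_qshift j p :
  log_shift (qshift q j p) = qshift q j (log_shift p).
Proof.
rewrite !qshift_comp_map /log_shift; set f := qshift_laurent_rmorphism j.
have fX : map_poly f ('X + 1%:P) = 'X + 1%:P.
  exact: map_poly_XaddC1.
rewrite map_comp_poly fX -!comp_polyA !comp_polyD !comp_polyX !comp_polyC.
by congr (_ \Po _); rewrite addrAC.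
Qed.

Lemma log_shift_logconst c : log_shift (logconst E c) = logconst E c.
Proof. exact: comp_polyC. Qed.

Lemma log_shift_qdiffop D p :
  log_shift (qdiffop_app q D p) = qdiffop_app q D (log_shift p).
Proof.
rewrite /qdiffop_app rmorph_sum; apply: eq_bigr => j _.
by rewrite -log_shift_qshift; exact: comp_polyZ.
Qed.

Definition yminus0 (c : E) (p : {poly {laurent E}}) :=
  qshift q 1 p - logconst E c * p.

Definition yprod0 (l : seq int) (p : {poly {laurent E}}) :=
  foldr (fun a r => yminus0 (q ^ a) r) p l.

Lemma yprod_appE l f n : yprod_app q l f n = yprod0 l (f n).
Proof.
elim: l => // a l IHl; rewrite /= /yminus0 -IHl.
by rewrite -[logconst E _ * _]fpsCM.
Qed.

Lemma yminus0_slinear c : slinear (logconst E) (yminus0 c).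
Proof.
by move=> d x y; rewrite /yminus0 qshift_slinear; ring.
Qed.

Lemma yprod0_slinear l : slinear (logconst E) (yprod0 l).
Proof.
by elim: l => [|a l IHl] c x y //=; rewrite IHl yminus0_slinear.
Qed.

Lemma log_shift_yprod0 l p : log_shift (yprod0 l p) = yprod0 l (log_shift p).
Proof.
elim: l => //= a l <-; rewrite /yminus0 rmorphB rmorphM /=.
by rewrite log_shift_qshift log_shift_logconst.
Qed.

Lemma coef_logconstM c p i : (logconst E c * p)`_i = laurentC c * p`_i.
Proof. exact: coefCM. Qed.

Hypothesis q_not_root1 : forall n : int, n != 0 -> q ^ n != 1.
Hypothesis charE : forall n, n.+1%:R != 0 :> E.

(** On x^n the operator y - q^a is multiplication by q^n - q^a, which is thus invertible for every n
    other than a. *)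
Lemma exprz_inj : injective (fun n : int => q ^ n).
Proof.
move=> m n /= qmn; apply/eqP; rewrite -subr_eq0; apply: contraT => /q_not_root1.
by rewrite expfzDr // -invr_expz qmn divff ?eqxx // expfz_neq0.
Qed.

Lemma laurent_torsion_free (a : {laurent E}) n : a *+ n.+1 = 0 -> a = 0.
Proof.
move=> /laurentP an0; apply/laurentP => m; rewrite laurent0E.
apply: (field_torsion_free charE (n := n)).
by rewrite -laurent_natE an0 laurent0E.
Qed.

Lemma coef_yminus0_top c (p : {poly {laurent E}}) n : (size p <= n.+1)%N ->
  (yminus0 c p)`_n = qshift_laurent q 1 p`_n - laurentC c * p`_n.
Proof.
move=> le_p; rewrite coefB coef_logconstM qshiftE /= coef_comp_XaddC_top.
  by rewrite coef_map.
exact: leq_trans (size_poly _ _) le_p.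
Qed.

(** The last term comes from log_q x -> log_q x + 1. At the resonant monomial x^a, where the first
    two cancel for c = q^a, it is the only one left. *)
Lemma coef_yminus0_pred c (p : {poly {laurent E}}) n : (size p <= n.+2)%N ->
  (yminus0 c p)`_n = qshift_laurent q 1 p`_n - laurentC c * p`_n +
    qshift_laurent q 1 p`_n.+1 *+ n.+1.
Proof.
move=> le_p; rewrite coefB coef_logconstM qshiftE /= coef_comp_XaddC_pred.
  by rewrite !coef_map mul1r addrAC.
exact: leq_trans (size_poly _ _) le_p.
Qed.

(* Induction on the degree in log_q x: the monomial x^n of the leading
   coefficient is hit from degree d if n <> a, and from degree d + 1 if n = a,
   because y - q^a lowers the degree of x^a (log_q x)^(d + 1). *)
Lemma yminus0_surj a (w : {poly {laurent E}}) : exists p, yminus0 (q ^ a) p = w.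
Proof.
have [N] := ubnP (size w); elim: N w => // N IHN w; rewrite ltnS => le_w.
case: N IHN le_w => [_|d IHd le_w].
  rewrite leqn0 size_poly_eq0 => /eqP->; exists 0.
  exact: slinear0 (yminus0_slinear _).
have bndB : exists M : int, forall n, n < M ->
    (if n == a then 0 else w`_d n / (q ^ n - q ^ a)) = 0.
  have [M wM] := laurent_bounded w`_d; exists M => n /wM->.
  by rewrite mul0r if_same.
have bndC : exists M : int, forall n, n < M ->
    (if n == a then w`_d a / (q ^ a * d.+1%:R) else 0) = 0.
  by exists a => n; rewrite lt_neqAle => /andP[/negPf-> _].
pose p := (Laurent bndC)%:P * 'X^(d.+1) + (Laurent bndB)%:P * 'X^d.
have pS : p`_d.+1 = Laurent bndC.
  by rewrite coefD !coefCM !coefXn eqxx (gtn_eqF (ltnSn d)) mulr1 mulr0 addr0.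
have pd : p`_d = Laurent bndB.
  by rewrite coefD !coefCM !coefXn eqxx (ltn_eqF (ltnSn d)) mulr1 mulr0 add0r.
have pj j : (d.+1 < j)%N -> p`_j = 0.
  move=> lt_j; rewrite coefD !coefCM !coefXn (gtn_eqF lt_j).
  by rewrite (gtn_eqF (ltnW lt_j)) !mulr0 addr0.
have le_p : (size p <= d.+2)%N by apply/leq_sizeP.
have [|r rE] := IHd (w - yminus0 (q ^ a) p); last first.
  exists (p + r).
  by rewrite (slinearD _ _ (yminus0_slinear _)) rE addrC subrK.
rewrite ltnS; apply/leq_sizeP => j; rewrite coefB leq_eqVlt => /predU1P[<-|].
  rewrite (coef_yminus0_pred _ le_p) pS pd; apply/laurentP => n.
  rewrite laurent0E laurentDE laurentNE !laurentDE laurentNE laurent_natE.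
  rewrite laurentCM /= mul1r; have [->|na] := eqVneq n a.
    rewrite !mulr0 subrr add0r invfM mulrCA mulVKf ?expfz_neq0 //.
    by rewrite -[_ *+ d.+1]mulr_natr divfK ?subrr.
  rewrite mulr0 mul0rn addr0 -mulrBl mulrC divfK ?subrr // subr_eq0.
  by apply: contra na => /eqP /exprz_inj ->.
rewrite leq_eqVlt => /predU1P[<-|lt_j].
  rewrite coef_yminus0_top // pS (nth_default 0 le_w) sub0r.
  apply/laurentP => n.
  rewrite laurent0E laurentNE laurentDE laurentNE laurentCM /= mul1r.
  by have [->|_] := eqVneq n a; rewrite ?mulr0 subrr oppr0.
have le_pj : (size p <= j.+1)%N := leq_trans le_p (leqW lt_j).
rewrite (coef_yminus0_top _ le_pj) (pj _ lt_j).
rewrite (nth_default 0 (leq_trans le_w (ltnW lt_j))).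
by rewrite mulr0 raddf0 subr0 subr0.
Qed.

(** The leading coefficient in log_q x is killed by y - q^a, hence is a multiple of x^a. In positive
    degree d + 1, the coefficient of x^a one step below equals (d+1) q^a times that multiple, which
    forces it to vanish. *)
Lemma yminus0_kernel a p : yminus0 (q ^ a) p = 0 ->
  exists c, p = logconst E c * (laurent_shift a 1)%:P.
Proof.
move=> kp.
have kcoef (b : {laurent E}) n : n != a ->
    (qshift_laurent q 1 b - laurentC (q ^ a) * b) n = 0 -> b n = 0.
  move=> na; rewrite laurentDE laurentNE laurentCM /= mul1r -mulrBl => /eqP.
  rewrite mulf_eq0 subr_eq0 => /orP[/eqP/exprz_inj/eqP|/eqP//].
  by rewrite (negPf na).
case size_p: (size p) => [|[|d]].
- exists 0; rewrite rmorph0 mul0r; apply/eqP.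
  by rewrite -size_poly_eq0 size_p.
- have pC := size1_polyC (eq_leq size_p).
  exists (p`_0 a); rewrite -[logconst _ _]/((laurentC _)%:P) [LHS]pC.
  rewrite -polyCM; congr (_%:P); apply/laurentP => n.
  rewrite laurentCM /= /laurent_shift_coef.
  have [->|na] := eqVneq n a; first by rewrite lexx subrr /= mulr1.
  transitivity (0 : E).
    apply: (kcoef _ _ na); rewrite -coef_yminus0_top ?size_p //.
    by rewrite kp coef0 laurent0E.
  case: ifP => [an|]; rewrite ?mulr0 // fps1E absz_eq0 subr_eq0 (negPf na).
  by rewrite mulr0.
- exfalso; have : p`_d.+1 = 0.
    apply/laurentP => n; rewrite laurent0E.
    have [->|na] := eqVneq n a; last first.
      apply: (kcoef _ _ na); rewrite -coef_yminus0_top ?size_p //.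
      by rewrite kp coef0 laurent0E.
    have := @coef_yminus0_pred (q ^ a) p d (eq_leq size_p).
    rewrite kp coef0 => /laurentP/(_ a).
    rewrite laurent0E laurentDE laurent_natE laurentDE laurentNE laurentCM /=.
    rewrite mul1r subrr add0r => /esym /(field_torsion_free charE) /eqP.
    by rewrite mulf_eq0 (negPf (expfz_neq0 _ q0)) => /eqP.
  apply/eqP; have := lead_coefE p; rewrite size_p /= => <-.
  by rewrite lead_coef_eq0 -size_poly_eq0 size_p.
Qed.

Lemma yminus0_monomial a : yminus0 (q ^ a) (laurent_shift a 1)%:P = 0.
Proof.
rewrite /yminus0 qshiftE /= map_polyC comp_polyC -polyCM -polyCB.
rewrite -[RHS]/(0%:P); congr (_%:P); apply/laurentP => n.
rewrite laurent0E laurentDE laurentNE laurentCM /= /laurent_shift_coef.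
have [->|na] := eqVneq n a; first by rewrite mul1r subrr.
case: ifP => [an|_]; last by rewrite !mulr0 subr0.
by rewrite fps1E absz_eq0 subr_eq0 (negPf na) !mulr0 subr0.
Qed.

Lemma yprod0_surj l w : exists p, yprod0 l p = w.
Proof.
elim: l w => [|a l IHl] w; first by exists w.
by have [r <-] := yminus0_surj a w; have [p <-] := IHl r; exists p.
Qed.

End QShift.

Section LogDifference.
Variable R : comNzRingType.
Implicit Type p : {poly R}.

Definition log_diff p := log_shift p - p.

(** T - 1 lowers a positive degree by exactly one: it multiplies the leading coefficient by the
    degree, and [torsion_free] keeps the product nonzero. *)
Lemma size_log_diff_nilpotent k p :
    (forall (x : R) n, x *+ n.+1 = 0 -> x = 0) ->
  iter k log_diff p = 0 -> (size p <= k)%N.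
Proof.
move=> torsion_free; elim: k p => [|k IHk] p.
  by move=> /= ->; rewrite size_poly0.
rewrite iterSr => /IHk le_d; rewrite leqNgt; apply/negP => lt_p.
case size_p: (size p) lt_p => [|[|n]] //; rewrite ltnS => le_kn.
have : (log_diff p)`_n = 0 by rewrite nth_default ?(leq_trans le_d).
rewrite coefB coef_comp_XaddC_pred ?size_p // addrC addrA addNr add0r mul1r.
move=> /torsion_free pn.
have : lead_coef p = 0 by rewrite lead_coefE size_p.
by move=> /eqP; rewrite lead_coef_eq0 -size_poly_eq0 size_p.
Qed.

End LogDifference.

(** * The kernel of P under extension of the base field *)

Section ScalarExtension.
Variables (E E' : fieldType) (iota : {rmorphism E -> E'}) (q : E).

Definition laurent_poly_map : {poly {laurent E}} -> {poly {laurent E'}} :=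
  map_poly (laurent_map iota).

HB.instance Definition _ :=
  GRing.RMorphism.copy laurent_poly_map (map_poly (laurent_map iota)).

Lemma laurent_poly_map_logconst c :
  laurent_poly_map (logconst E c) = logconst E' (iota c).
Proof.
rewrite [LHS](map_polyC (laurent_map iota)); congr (_%:P).
by apply/laurentP => n /=; case: ifP; rewrite ?rmorph0.
Qed.

Lemma laurent_poly_map_qshift j p :
  laurent_poly_map (qshift q j p) = qshift (iota q) j (laurent_poly_map p).
Proof.
rewrite /laurent_poly_map /qshift map_comp_poly; congr (_ \Po _).
  by rewrite rmorphD /= map_polyX map_polyC /= rmorph_int.
apply/polyP => i; rewrite !coef_map; apply/laurentP => n /=.
by rewrite [LHS](rmorphM iota) fmorphXz.
Qed.

Lemma laurent_poly_map_log_shift p :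
  laurent_poly_map (log_shift p) = log_shift (laurent_poly_map p).
Proof.
rewrite /laurent_poly_map /log_shift map_comp_poly; congr (_ \Po _).
exact: map_poly_XaddC1.
Qed.

Lemma laurent_poly_map_yprod0 l p :
  laurent_poly_map (yprod0 q l p) = yprod0 (iota q) l (laurent_poly_map p).
Proof.
elim: l => //= a l IHl; rewrite /yminus0 rmorphB rmorphM /=.
by rewrite laurent_poly_map_qshift laurent_poly_map_logconst fmorphXz IHl.
Qed.

Hypothesis q0 : q != 0.
Hypothesis q_not_root1 : forall n : int, n != 0 -> q ^ n != 1.
Hypothesis charE : forall n, n.+1%:R != 0 :> E.

(* The basis of ker (A B) is a basis of ker B together with a preimage under B
   of a basis of ker A; independence over E' follows by applying B. *)
Lemma yprod0_kernel_basis (l : seq int) :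
  exists g : nat -> {poly {laurent E}},
    [/\ forall i, (i < size l)%N -> yprod0 q l (g i) = 0,
        forall p, yprod0 q l p = 0 ->
          exists c : nat -> E, p = \sum_(i < size l) logconst E (c i) * g i
      & forall c : nat -> E',
          \sum_(i < size l) logconst E' (c i) * laurent_poly_map (g i) = 0 ->
          forall i, (i < size l)%N -> c i = 0].
Proof.
have iq0 : iota q != 0 by rewrite fmorph_eq0.
elim: l => [|a l [g [gK g_span g_free]]].
  exists (fun=> 0); split=> // p /= ->.
  by exists (fun=> 0); rewrite big_ord0.
have linP := yprod0_slinear q0 l.
have [u uE] := yprod0_surj q0 q_not_root1 charE l (laurent_shift a 1)%:P.
exists (fun i => if i is j.+1 then g j else u); split.
- case=> [_|i lt_i] /=; first by rewrite uE yminus0_monomial.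
  by rewrite gK // (slinear0 (yminus0_slinear q0 _)).
- move=> p /= /(yminus0_kernel q0 q_not_root1 charE)[c pE].
  have [|d dE] := g_span (p - logconst E c * u).
    rewrite (slinearD _ _ linP) (slinearN _ linP) (slinearZ _ _ linP) pE uE.
    by rewrite subrr.
  exists (fun i => if i is j.+1 then d j else c).
  by rewrite big_ord_recl /= -dE addrC subrK.
- move=> c; rewrite big_ord_recl /= => cE.
  have linP' := yprod0_slinear iq0 l.
  have c0 : c 0%N = 0.
    have := congr1 (yprod0 (iota q) l) cE.
    rewrite (slinear0 linP') (slinearD _ _ linP') (slinearZ _ _ linP').
    rewrite (slinear_sum _ _ _ linP') -laurent_poly_map_yprod0 uE.
    rewrite big1 => [|i _].
      rewrite addr0 => /(congr1 (fun p : {poly {laurent E'}} => p`_0 a)).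
      rewrite coef_logconstM laurentCM coef_map coefC coef0 laurent0E /=.
      by rewrite /laurent_shift_coef lexx subrr /= rmorph1 mulr1.
    rewrite (slinearZ _ _ linP') -laurent_poly_map_yprod0.
    by rewrite gK ?rmorph0 ?mulr0 //; apply: (ltn_ord i).
  case=> [//|i] lt_i; apply: (g_free (fun j => c j.+1)) => //.
  by move: cE; rewrite c0 rmorph0 mul0r add0r.
Qed.

End ScalarExtension.

(** Primary decomposition: by Cayley-Hamilton the kernels of the pairwise coprime powers (A - r)^m,
    with m the multiplicity of r, span the whole space. *)
Lemma generalized_eigenbasis (G : fieldType) k (A : 'M[G]_k) (rs : seq G) :
    char_poly A = \prod_(r <- rs) ('X - r%:P) ->
  exists (V U : 'M[G]_k) (a : 'I_k -> G), [/\ V *m U = 1%:M, U *m V = 1%:M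
    & forall i, a i \in rs /\
      iter k (fun w => w *m (A - (a i)%:M)) (row i V) = 0].
Proof.
(* Evaluating polynomials at A requires the nonzero ring of matrices of positive size. *)
case: k A => [|k] A chA.
  by exists 1%:M, 1%:M, (fun=> 0); split; rewrite ?mulmx1 //; case.
have size_rs : size rs = k.+1.
  by apply: succn_inj; rewrite -(size_prod_XsubC rs id) -chA size_char_poly.
pose us := undup rs; pose I := 'I_(size us).
pose p_ (i : I) := ('X - (us`_i)%:P) ^+ count_mem us`_i rs.
have chE : char_poly A = \prod_i p_ i.
  rewrite chA -(prodr_undup_exp_count rs xpredT (fun r : G => 'X - r%:P)).
  by rewrite (big_nth 0) big_mkord.
have co_p : {in predT &, forall i j : I, j != i -> coprimep (p_ i) (p_ j)}.
  move=> i j _ _ ji; apply/coprimep_expl/coprimep_expr.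
  rewrite coprimep_XsubC root_XsubC (nth_uniq 0) ?undup_uniq //.
have full_ker : (1%:M <= \sum_i kermxpoly A (p_ i))%MS.
  rewrite -(kermxpoly_prod A co_p) -chE; apply/sub_kermxP.
  by rewrite Cayley_Hamilton mulmx0.
(* All rows of all kernels are stacked into one matrix of full rank. The basis is extracted from
   these rows, so each basis vector stays in a single kernel. *)
pose J := (I * 'I_k.+1)%type.
pose rw (x : J) := row x.2 (kermxpoly A (p_ x.1)).
pose C : 'M_(#|{: J}|, k.+1) := \matrix_a rw (enum_val a).
have fC : row_full C.
  rewrite -sub1mx; apply: submx_trans full_ker _; apply/sumsmx_subP => i _.
  apply/row_subP => j.
  have -> : row j (kermxpoly A (p_ i)) = row (enum_rank ((i, j) : J)) C.
    by rewrite rowK enum_rankK.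
  exact: row_sub.
pose x (i : 'I_k.+1) := enum_val (fullrankfun fC i).
pose V := rowsub (fullrankfun fC) C; have V_unit := fullrowsub_unit fC.
exists V, (invmx V), (fun i => us`_(x i).1); split; rewrite ?mulmxV ?mulVmx //.
move=> i; split; first by rewrite -mem_undup mem_nth.
rewrite row_rowsub rowK -/(x i) /rw; set w := row _ _; set a := us`_ _.
have wK : w *m horner_mx A (p_ (x i).1) = 0.
  by apply/sub_kermxP; apply: row_sub.
have iterE n : iter n (fun w => w *m (A - a%:M)) w = w *m (A - a%:M) ^+ n.
  by elim: n => [|n IHn]; rewrite ?mulmx1 //= IHn exprSr -mulmxA.
(* A multiplicity is at most the dimension, so one exponent suits all eigenvalues. *)
have le_c : (count_mem a rs <= k.+1)%N by rewrite -size_rs count_size.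
move: wK; rewrite rmorphXn rmorphB /= horner_mx_X horner_mx_C -/a => wK.
have := iterE k.+1; rewrite -[X in _ ^+ X](subnKC le_c) exprD mulmxA wK mul0mx.
exact.
Qed.

Lemma laurent_generalized_eigenbasis (C : fieldType) k (A : 'M[{laurent C}]_k)
    (rs : seq {laurent C}) :
    char_poly A = \prod_(r <- rs) ('X - r%:P) ->
  exists (V U : 'M[{laurent C}]_k) (a : 'I_k -> {laurent C}),
    [/\ V *m U = 1%:M, U *m V = 1%:M
    & forall i, a i \in rs /\
      iter k (fun w => w *m (A - (a i)%:M)) (row i V) = 0].
Proof. exact: (@generalized_eigenbasis (laurent_field C)). Qed.

(** Coordinates are row vectors: T and changes of basis act on them by multiplication on the
    right. *)
Lemma lincomb_mulmx (A B : comNzRingType) (phi : {rmorphism A -> B}) m n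
    (c : 'rV[A]_m) (P : 'M[A]_(m, n)) (b : 'I_n -> B) :
  \sum_i phi (c 0 i) * (\sum_j phi (P i j) * b j) =
  \sum_j phi ((c *m P) 0 j) * b j.
Proof.
under eq_bigr => i _ do rewrite mulr_sumr.
rewrite exchange_big; apply: eq_bigr => j _ /=.
rewrite mxE rmorph_sum mulr_suml; apply: eq_bigr => i _.
by rewrite rmorphM mulrA.
Qed.

(** * The series x^lambda *)

Section ExpLogPower.
Variables (E W : comNzRingType) (s : {rmorphism E -> W}).
Variables (T : {rmorphism W -> W}) (x : W) (eps nu : {fps E}).
Hypothesis torsion_free : forall (w : W) n, w *+ n.+1 = 0 -> w = 0.
Hypotheses (Tx : T x = x + 1) (Ts : forall c, T (s c) = s c).
Hypotheses (Deps : fps_deriv eps = eps) (eps0 : eps 0%N = 1) (nu0 : nu 0%N = 0).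

Let e := fps_map s eps.
Let u := fps_map s nu * fpsC x.

Let De : fps_deriv e = e.
Proof. by rewrite /e -[in RHS]Deps; apply/fpsP => n; rewrite /= -!rmorphMn. Qed.

Let e0 : e 0%N = 1. Proof. by rewrite /= eps0 rmorph1. Qed.

Let s_nu0 : fps_map s nu 0%N = 0. Proof. by rewrite /= nu0 rmorph0. Qed.

Let u0 : u 0%N = 0. Proof. by rewrite /u fpsM0E s_nu0 mul0r. Qed.

Lemma exp_invertible : exists e', fps_comp e u * e' = 1.
Proof.
exists (fps_comp e (- u)).
rewrite -(fps_expD torsion_free De e0 u0) ?fpsNE ?u0 ?oppr0 //.
rewrite subrr; apply/fpsP => n.
rewrite -[LHS]/(\sum_(m < n.+1) e m * (0 ^+ m : {fps _}) n).
rewrite big_ord_recl big1 => [|i _]; first by rewrite addr0 expr0 e0 mul1r.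
by rewrite expr0n fps0E mulr0.
Qed.

(** Here x stands for log_q x. As T fixes scalars, it sends u = nu x to u + nu, and the exponential
    turns the added nu into the factor exp nu. *)
Lemma exp_translate :
  fps_map T (fps_comp e u) = fps_map s (fps_comp eps nu) * fps_comp e u.
Proof.
have Ts_fps c : fps_map T (fps_map s c) = fps_map s c.
  by apply/fpsP => n; apply: Ts.
rewrite fps_map_comp Ts_fps rmorphM /= Ts_fps.
have -> : fps_map T (fpsC x) = fpsC x + 1.
  apply/fpsP => n; rewrite fpsDE fps1E /=.
  by case: eqP; rewrite ?Tx ?rmorph0 ?addr0.
rewrite mulrDr mulr1 (fps_expD torsion_free De e0 u0) //.
by rewrite mulrC fps_map_comp.
Qed.

End ExpLogPower.

Section XPow.
Variable E : fieldType.
Hypothesis charE : forall n, n.+1%:R != 0 :> E.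

Lemma poly_laurent_torsion_free (p : {poly {laurent E}}) n :
  p *+ n.+1 = 0 -> p = 0.
Proof.
move=> pn0; apply/polyP => i; rewrite coef0.
apply: (laurent_torsion_free charE (n := n)).
by rewrite -coefMn pn0 coef0.
Qed.

Let exp0 : fps_exp_series E 0%N = 1. Proof. by rewrite /= invr1. Qed.
Let log0 (mu : {fps E}) : fps_log mu 0%N = 0. Proof. exact: fps_comp0E. Qed.

Lemma xpow_invertible (mu : {fps E}) : exists e', xpow mu * e' = 1.
Proof.
exact: (@exp_invertible _ _ (logconst E) 'X _ _ poly_laurent_torsion_free
  (fps_deriv_exp charE) exp0 (log0 mu)).
Qed.

Lemma log_shift_xpow (mu : {fps E}) : (mu - 1) 0%N = 0 ->
  fps_map (@log_shift _) (xpow mu) = fps_scalar E mu * xpow mu.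
Proof.
move=> mu1; rewrite -[X in fps_scalar E X](fps_exp_log charE mu1).
apply: (@exp_translate _ _ (logconst E) (@log_shift _) 'X _ _
  poly_laurent_torsion_free _ _ (fps_deriv_exp charE) exp0 (log0 mu)).
  by rewrite -polyC1; apply: comp_polyX.
exact: log_shift_logconst.
Qed.

End XPow.

(** * Monodromy *)

(** Multiplying a relation by a power of the variable makes its coefficients power series. *)
Lemma laurent_free_lift (E W : comNzRingType) (s : {rmorphism E -> W}) k
    (g : 'I_k -> {fps W}) :
    (forall c : 'I_k -> {fps E}, \sum_i fps_map s (c i) * g i = 0 ->
       forall i, c i = 0) ->
  forall c : 'I_k -> {laurent E},
    \sum_i laurent_map s (c i) * laurent_of_fps (g i) = 0 -> forall i, c i = 0.
Proof.
move=> free_g c cg0 i; have [M [d dE]] := laurent_clear_denominators c.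
have MK (a : {laurent E}) : laurent_shift (- M) 1 * (laurent_shift M 1 * a) = a.
  rewrite mulrA laurent_mul_shift addNr mulr1 -/(laurent_of_fps 1).
  by rewrite (rmorph1 (@laurent_of_fps E)) mul1r.
have d0 : forall j, d j = 0.
  apply: free_g; apply: (@laurent_of_fps_inj W); rewrite rmorph0.
  rewrite -[RHS](mulr0 (laurent_map s (laurent_shift M 1))) -cg0.
  rewrite rmorph_sum mulr_sumr.
  apply: eq_bigr => j _; rewrite mulrA -(rmorphM (laurent_map s)) dE.
  rewrite (rmorphM (@laurent_of_fps W)); congr (_ * _).
  exact/esym/laurent_map_of_fps.
by rewrite -(MK (c i)) dE d0 rmorph0 mulr0.
Qed.

Section Monodromy.
Variables (E : fieldType) (q : E) (l : seq int) (Q : qdiffop_fps E).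
Hypothesis q0 : q != 0.
Hypothesis Q_t : forall j, Q 0%N j = 0.

(** The t-coefficients of P + Q; by [Q_t] the constant one is P alone. *)
Definition equation_operator n : {poly {laurent E}} -> {poly {laurent E}} :=
  if n is 0 then yprod0 q l else qdiffop_app q (Q n).

Lemma equation_operator_slinear n : slinear (logconst E) (equation_operator n).
Proof.
by case: n => [|n]; [exact: yprod0_slinear | exact: qdiffop_app_slinear].
Qed.

Lemma log_shift_equation_operator n p :
  log_shift (equation_operator n p) = equation_operator n (log_shift p).
Proof.
by case: n => [|n]; [exact: log_shift_yprod0 | exact: log_shift_qdiffop].
Qed.

Lemma solutionP f : solution q l Q f <-> in_fps_kernel equation_operator f.
Proof.
have eqE n : (yprod_app q l f + qdiffop_fps_app q Q f) n =
    \sum_(i < n.+1) equation_operator i (f (n - i)%N).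
  rewrite fpsDE yprod_appE [in RHS]big_ord_recl subn0; congr (_ + _).
  rewrite /= big_ord_recl [X in X + _]big1 ?add0r // => j _.
  by rewrite Q_t scale0r.
split=> [sf n|kf]; first by rewrite -eqE sf fps0E.
by apply/fpsP => n; rewrite eqE kf fps0E.
Qed.

Lemma solution_log_shift f :
  solution q l Q f -> solution q l Q (fps_map (@log_shift _) f).
Proof.
move=> /solutionP kf; apply/solutionP => n.
have := congr1 (@log_shift _) (kf n); rewrite rmorph0 rmorph_sum => kTf.
rewrite -[RHS]kTf.
by apply: eq_bigr => i _; apply/esym/log_shift_equation_operator.
Qed.

Hypothesis q_not_root1 : forall n : int, n != 0 -> q ^ n != 1.
Hypothesis charE : forall n, n.+1%:R != 0 :> E.
Variables (E' : fieldType) (iota : {rmorphism E -> E'}).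

(** The second conclusion concerns the larger field E'. It serves after extension of scalars, and
    independence over E follows from it because [iota] is injective. *)
Lemma solution_basis k : size l = k ->
  exists g : 'I_k -> {fps {poly {laurent E}}},
    free_basis (fps_scalar E) (solution q l Q) g /\
    forall c : 'I_k -> E',
      \sum_i logconst E' (c i) * laurent_poly_map iota (g i 0%N) = 0 ->
      forall i, c i = 0.
Proof.
move=> <-{k}.
have [b [bK b_span b_free]] := yprod0_kernel_basis iota q0 q_not_root1 charE l.
have /choice[g gP] (i : 'I_(size l)) : exists f,
    in_fps_kernel equation_operator f /\ f 0%N = b i.
  have [||f kf f0] := fps_kernel_lift (R := equation_operator) (w := b i).
  - exact: yprod0_surj.
  - exact: bK.
  - by exists f.
have g0 i : g i 0%N = b i := proj2 (gP i).
have gK i : in_fps_kernel equation_operator (g i) := proj1 (gP i).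
have ord_fun (T : Type) (x : T) (c : 'I_(size l) -> T) :
    exists d : nat -> T, forall i : 'I_(size l), d i = c i.
  exists (fun n => if insub n is Some i then c i else x) => i.
  by rewrite valK.
have free0 (c : 'I_(size l) -> E') :
    \sum_i logconst E' (c i) * laurent_poly_map iota (g i 0%N) = 0 ->
    forall i, c i = 0.
  have [d dE] := ord_fun _ 0 c => cg0 i; rewrite -dE; apply: b_free => //.
  by rewrite -[RHS]cg0; apply: eq_bigr => j _; rewrite dE g0.
exists g; split=> //; split=> [f|].
  split=> [/solutionP kf|[c ->]].
    apply: (fps_kernel_span equation_operator_slinear gK) kf => w w0.
    have [c ->] := b_span w w0; exists (fun i => c i).
    by apply: eq_bigr => i _; rewrite g0.
  apply/solutionP; apply: (in_fps_kernel_sum equation_operator_slinear) => i _.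
  exact: (in_fps_kernelZ equation_operator_slinear).
apply: fps_free_lift => c cg0 i; apply: (fmorph_inj iota); rewrite rmorph0.
apply: (free0 (iota \o c)).
rewrite -[RHS](rmorph0 (laurent_poly_map iota)) -cg0 rmorph_sum.
by apply: eq_bigr => j _; rewrite rmorphM /= laurent_poly_map_logconst.
Qed.

End Monodromy.

(* Compare leading coefficients in log_q x. *)
Lemma log_shift_eigenvalue (E : fieldType) (a : E) (p : {poly {laurent E}}) :
  p != 0 -> log_shift p = logconst E a * p -> a = 1.
Proof.
move=> p0 /(congr1 (fun r : {poly {laurent E}} => r`_(size p).-1)).
rewrite coef_comp_XaddC_top ?leqSpred // coef_logconstM -lead_coefE => pE.
have [n pn] : exists n, lead_coef p n != 0.
  apply: contrapT => /forallNP pn; move: p0; rewrite -lead_coef_eq0 => /eqP[].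
  apply/laurentP => n; rewrite laurent0E.
  by apply/eqP; apply: contra_notT (pn n).
have /laurentP/(_ n) := pE; rewrite laurentCM -[LHS]mul1r => /(mulIf pn).
by [].
Qed.

(** As T e = a e, conjugation by e turns T - a into a (T - 1). T fixes a, so k iterations contribute
    the factor a^k, which b^k cancels. *)
Lemma iter_twisted_difference (W : comNzRingType) (T : {rmorphism W -> W})
    (a b e e' f : W) k :
    T e = a * e -> T a = a -> a * b = 1 -> e * e' = 1 ->
    iter k (fun g => T g - a * g) f = 0 ->
  iter k (fun g => T g - g) (e' * f) = 0.
Proof.
move=> Te Ta ab ee'; set N := fun g => T g - a * g; set D := fun g => T g - g.
move=> Nf; set h := e' * f.
have fE : f = e * h by rewrite mulrA ee' mul1r.
have NE g : N (e * g) = a * (e * D g) by rewrite /N rmorphM Te /D; ring.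
have NS g : N (a * g) = a * N g by rewrite /N rmorphM Ta; ring.
have iterNS j g : iter j N (a * g) = a * iter j N g.
  by elim: j => //= j ->.
have iterE j g : iter j N (e * g) = a ^+ j * (e * iter j D g).
  elim: j g => [|j IHj] g; first by rewrite mul1r.
  by rewrite !iterSr NE iterNS IHj exprS mulrA.
transitivity (b ^+ k * (e' * iter k N f)); last by rewrite Nf !mulr0.
rewrite fE iterE.
transitivity ((a * b) ^+ k * (e * e') * iter k D h).
  by rewrite ab ee' expr1n !mul1r.
by rewrite exprMn; ring.
Qed.

(** Divided by [xpow mu], f is killed by (T - 1)^k coefficient by coefficient. Every coefficient has
    size at most k, so the polynomial variable can be taken out of the series. *)
Lemma generalized_eigenvector_log_degree (E : fieldType) (mu : {fps E}) k f :
    (forall n, n.+1%:R != 0 :> E) -> (mu - 1) 0%N = 0 ->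
    iter k (fun g => fps_map (@log_shift _) g - fps_scalar E mu * g) f = 0 ->
  exists2 h : {poly {fps {laurent E}}}, (size h <= k)%N &
    f = xpow mu * fps_of_poly h.
Proof.
move=> charE mu1 Nf; have [e' ee'] := xpow_invertible charE mu.
have [|m mum] := @fps_invertible E mu.
  have /eqP := mu1; rewrite fpsDE fpsNE fps1E subr_eq0 => /eqP->.
  exact: oner_neq0.
have Tmu : fps_map (@log_shift _) (fps_scalar E mu) = fps_scalar E mu.
  by apply/fpsP => n; apply: log_shift_logconst.
have smum : fps_scalar E mu * fps_scalar E m = 1.
  apply: etrans (rmorph1 (fps_scalar E)); rewrite -mum.
  exact/esym/(rmorphM (fps_scalar E)).
have Dh := iter_twisted_difference (log_shift_xpow charE mu1) Tmu smum ee' Nf.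
have iterDE j h n :
    iter j (fun g => fps_map (@log_shift {laurent E}) g - g) h n =
    iter j (@log_diff _) (h n).
  by elim: j => //= j; rewrite /log_diff => <-.
have [n|g le_g gE] := @fps_of_poly_surj _ k (e' * f).
  apply: size_log_diff_nilpotent (@laurent_torsion_free _ charE) _.
  by rewrite -iterDE Dh fps0E.
by exists g => //; rewrite gE mulrA ee' mul1r.
Qed.

Section MonodromyEigenvalues.
Variables (C : closedFieldType) (k : nat).
Variables (b : 'I_k -> {fps {poly {laurent C}}}) (B : 'M[{fps C}]_k).
Hypothesis charC : forall n, n.+1%:R != 0 :> C.
Hypothesis b_shift : forall i,
  fps_map (@log_shift _) (b i) = \sum_j fps_scalar C (B i j) * b j.
Hypothesis b_free0 : forall c : 'I_k -> C,
  \sum_i logconst C (c i) * b i 0%N = 0 -> forall i, c i = 0.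

(** The constant term of r is an eigenvalue of B at s = 0. An eigenvector combines the constant
    terms of the b_i into a nonzero p with T p = r(0) p, whence r(0) = 1. *)
Lemma monodromy_eigenvalue (rs : seq {fps C}) r :
  char_poly B = \prod_(s <- rs) ('X - s%:P) -> r \in rs -> (r - 1) 0%N = 0.
Proof.
move=> chB r_rs; pose B0 := map_mx (@fps_coef0 C) B.
have : eigenvalue B0 (r 0%N).
  rewrite eigenvalue_root_char -map_char_poly chB rmorph_prod /=.
  rewrite (big_rem r) //= rootM rmorphB /= map_polyX map_polyC /=.
  by rewrite root_XsubC eqxx.
move=> /eigenvalueP[v vB v0].
pose p := \sum_i logconst C (v 0 i) * b i 0%N.
have p0 : p != 0.
  apply: contraNneq v0 => /b_free0 v0; apply/eqP/rowP => i.
  by rewrite v0 mxE.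
have pE : log_shift p = logconst C (r 0%N) * p.
  transitivity (\sum_i logconst C (v 0 i) *
      \sum_j logconst C (B0 i j) * b j 0%N).
    rewrite rmorph_sum; apply: eq_bigr => i _; rewrite rmorphM /=.
    rewrite log_shift_logconst; congr (_ * _).
    rewrite -[LHS]/(fps_map (@log_shift _) (b i) 0%N) b_shift fps_sumE.
    by apply: eq_bigr => j _; rewrite fpsM0E mxE.
  rewrite lincomb_mulmx vB mulr_sumr; apply: eq_bigr => j _.
  by rewrite mxE rmorphM mulrA.
by rewrite fpsDE fpsNE fps1E (log_shift_eigenvalue p0 pE) subrr.
Qed.

(** [W] is the eigenvector matrix times one power of s that makes its entries power series; scaling
    all rows alike preserves both the eigenvector property and invertibility over [C((s))]. *)
Lemma log_eigenbasis (rs : seq {fps C}) :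
    char_poly B = \prod_(r <- rs) ('X - r%:P) ->
  exists (W : 'M[{fps C}]_k) (U : 'M[{laurent C}]_k),
    [/\ map_mx (@laurent_of_fps C) W *m U = 1%:M,
        U *m map_mx (@laurent_of_fps C) W = 1%:M
    & forall i, exists (mu : {fps C}) (h : {poly {fps {laurent C}}}),
      [/\ (mu - 1) 0%N = 0,
          \sum_j fps_scalar C (W i j) * b j = xpow mu * fps_of_poly h
        & (size h <= k)%N]].
Proof.
move=> chB; pose lof := @laurent_of_fps C.
have chA : char_poly (map_mx lof B) = \prod_(a <- map lof rs) ('X - a%:P).
  rewrite -map_char_poly chB rmorph_prod big_map; apply: eq_bigr => r _.
  by rewrite rmorphB /= map_polyX map_polyC.
have [V [U [a [VU UV aP]]]] := laurent_generalized_eigenbasis chA.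
have [M [d dE]] :=
  laurent_clear_denominators (fun x : 'I_k * 'I_k => V x.1 x.2).
pose s : {laurent C} := laurent_shift M 1.
pose s' : {laurent C} := laurent_shift (- M) 1.
have ss' : s * s' = 1.
  rewrite laurent_mul_shift addrN mulr1.
  exact: rmorph1 (@laurent_of_fps C).
pose W := \matrix_(i, j) d (i, j).
have WE : map_mx lof W = s *: V.
  by apply/matrixP => i j; rewrite !mxE; apply/esym/(dE (i, j)).
exists W, (s' *: U); rewrite WE -!scalemxAl -!scalemxAr !scalerA VU UV.
rewrite ss' [s' * s]mulrC ss' scale1r; split=> //.
move=> i; have [/mapP[mu mu_rs aiE] Vi] := aP i.
have mu1 := monodromy_eigenvalue chB mu_rs.
pose N (w : 'rV[{fps C}]_k) := w *m (B - mu%:M).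
(* The relation holds over [C((s))] and descends because [C[[s]]] embeds in it. *)
have NW : iter k N (row i W) = 0.
  suff /rowP N0 : map_mx lof (iter k N (row i W)) = 0.
    apply/rowP => j; apply: (@laurent_of_fps_inj C).
    by have := N0 j; rewrite !mxE rmorph0.
  have iterE n (w : 'rV[{fps C}]_k) : map_mx lof (iter n N w) =
      iter n (fun w => w *m (map_mx lof B - (a i)%:M)) (map_mx lof w).
    elim: n => //= n <-; rewrite map_mxM map_mxB map_scalar_mx.
    by rewrite aiE.
  rewrite iterE map_row WE.
  have iterZ n (w : 'rV_k) :
      iter n (fun w => w *m (map_mx lof B - (a i)%:M)) (s *: w) =
      s *: iter n (fun w => w *m (map_mx lof B - (a i)%:M)) w.
    by elim: n => //= n ->; rewrite scalemxAl.
  have -> : row i (s *: V) = s *: row i V by apply/rowP => j; rewrite !mxE.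
  by rewrite iterZ Vi scaler0.
pose comb (w : 'rV[{fps C}]_k) := \sum_j fps_scalar C (w 0 j) * b j.
have shiftE w : fps_map (@log_shift _) (comb w) - fps_scalar C mu * comb w =
    comb (N w).
  have -> : fps_map (@log_shift _) (comb w) = comb (w *m B).
    rewrite /comb -lincomb_mulmx rmorph_sum; apply: eq_bigr => j _.
    rewrite -b_shift rmorphM; congr (_ * _).
    by apply/fpsP => n; apply: log_shift_logconst.
  rewrite /N mulmxBr mul_mx_scalar /comb mulr_sumr -sumrB.
  apply: eq_bigr => j _.
  rewrite [in RHS]mxE rmorphD mulrDl; congr (_ + _).
  by rewrite !mxE rmorphN rmorphM mulNr mulrA.
have [|h le_h hE] :=
    generalized_eigenvector_log_degree (k := k) (f := comb (row i W)) charC mu1.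
  set N' := (fun f => _).
  have iterE n w : iter n N' (comb w) = comb (iter n N w).
    by elim: n => //= n ->; rewrite /N' shiftE.
  rewrite iterE NW /comb big1 // => j _.
  by rewrite mxE rmorph0 mul0r.
exists mu, h; split=> //; rewrite -hE; apply: eq_bigr => j _.
by rewrite [in RHS]mxE.
Qed.

End MonodromyEigenvalues.

(** * Bases after extension of scalars *)

Section ExtendedBasis.
Variables (K K' : fieldType) (iota : {rmorphism K -> K'}) (L : nat).
Variables (sol : {fps {poly {laurent K}}} -> Prop) (k : nat).
Variables (g : 'I_k -> {fps {poly {laurent K}}}).
Hypothesis g_basis : free_basis (fps_scalar K) sol g.
Hypothesis g_free0 : forall c : 'I_k -> K',
  \sum_i logconst K' (c i) * laurent_poly_map iota (g i 0%N) = 0 ->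
  forall i, c i = 0.

Definition fps_ext (f : {fps {poly {laurent K}}}) : {fps {poly {laurent K'}}} :=
  fps_ramify L.+1 (fps_map (laurent_poly_map iota) f).

HB.instance Definition _ := GRing.RMorphism.copy fps_ext
  (@fps_ramify _ L.+1 \o fps_map (laurent_poly_map iota)).

Lemma ext_mapE f : ext_map iota L.+1 f = laurent_of_fps (fps_ext f).
Proof. by []. Qed.

Lemma fps_ext_scalar c : fps_ext (fps_scalar K c) =
  fps_scalar K' (fps_ramify L.+1 (fps_map iota c)).
Proof.
rewrite /fps_ext /fps_scalar [RHS]fps_map_ramify; congr fps_ramify.
by apply/fpsP => n; apply: laurent_poly_map_logconst.
Qed.

Lemma fps_ext0E f : fps_ext f 0%N = laurent_poly_map iota (f 0%N).
Proof. exact: fps_ramify0E. Qed.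

(** Two reductions: from Laurent to power series coefficients, then to constant terms, which the
    ramification leaves unchanged. *)
Lemma fps_ext_basis_free (c : 'I_k -> {laurent K'}) :
  \sum_i laurent_scalar K' (c i) * laurent_of_fps (fps_ext (g i)) = 0 ->
  forall i, c i = 0.
Proof.
apply: laurent_free_lift => d; apply: fps_free_lift => e ge0.
by apply: g_free0; rewrite -[RHS]ge0; apply: eq_bigr => i _; rewrite fps_ext0E.
Qed.

Lemma extended_basis (W : 'M[{fps K'}]_k) (U : 'M[{laurent K'}]_k) :
    map_mx (@laurent_of_fps K') W *m U = 1%:M ->
    U *m map_mx (@laurent_of_fps K') W = 1%:M ->
  free_basis (laurent_scalar K')
    (scalar_extension (laurent_scalar K') (ext_map iota L.+1) sol)
    (fun i => laurent_of_fps (\sum_j fps_scalar K' (W i j) * fps_ext (g j))).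
Proof.
set V := map_mx _ W => VU UV; pose b j := laurent_of_fps (fps_ext (g j)).
have fE i : laurent_of_fps (\sum_j fps_scalar K' (W i j) * fps_ext (g j)) =
    \sum_j laurent_scalar K' (V i j) * b j.
  rewrite rmorph_sum; apply: eq_bigr => j _; rewrite mxE.
  rewrite (rmorphM (@laurent_of_fps _)); congr (_ * _).
  exact/esym/laurent_map_of_fps.
have combE (c : 'I_k -> {laurent K'}) :
    \sum_i laurent_scalar K' (c i) *
      laurent_of_fps (\sum_j fps_scalar K' (W i j) * fps_ext (g j)) =
    \sum_j laurent_scalar K' ((\row_i c i *m V) 0 j) * b j.
  apply: etrans (lincomb_mulmx _ _ _ _); apply: eq_bigr => i _.
  by rewrite fE mxE.
have [solE _] := g_basis; split=> [h|c].
  split=> [[n [c [m [m_sol ->]]]]|[c ->]].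
    have /choice[d dE] i := (solE (m i)).1 (m_sol i).
    (* The coordinates of the solutions [m i] in the basis g, moved to [K'((s))]; multiplying by [U]
       converts them to the basis given by [W]. *)
    pose D := \matrix_(i < n, j < k)
      laurent_of_fps (fps_ramify L.+1 (fps_map iota (d i j))).
    exists (fun i => ((\row_i c i *m D) *m U) 0 i); rewrite combE.
    have -> : \row_i ((\row_i c i *m D) *m U) 0 i = (\row_i c i *m D) *m U.
      by apply/rowP => i; rewrite mxE.
    rewrite -(mulmxA _ U V) UV mulmx1; apply: etrans (lincomb_mulmx _ _ _ _).
    apply: eq_bigr => i _; rewrite mxE.
    congr (_ * _); rewrite ext_mapE dE !rmorph_sum; apply: eq_bigr => j _.
    rewrite mxE !rmorphM /= fps_ext_scalar; congr (_ * _).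
    exact/esym/laurent_map_of_fps.
  rewrite combE.
  exists k, (fun j => (\row_i c i *m V) 0 j), g; split=> [i|//].
  apply/solE; exists (fun j => (j == i)%:R).
  rewrite (bigD1 i) //= eqxx rmorph1 mul1r big1 ?addr0 // => j /negPf->.
  by rewrite rmorph0 mul0r.
rewrite combE => /fps_ext_basis_free c0 i.
have : \row_i c i *m V = 0 by apply/rowP => j; rewrite c0 mxE.
move=> /(congr1 (mulmx^~ U)); rewrite -(mulmxA _ V U) VU mulmx1 mul0mx.
move=> /rowP/(_ i).
by rewrite !mxE.
Qed.

End ExtendedBasis.

(** * The field of rational functions in q *)

Lemma fraction_natr_neq0 (F : fieldType) : [pchar F] =i pred0 ->
  forall n, n.+1%:R != 0 :> {fraction {poly F}}.
Proof.
move=> /pcharf0P charF n.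
rewrite -(rmorph_nat (@tofrac {poly F})) tofrac_eq0.
by rewrite -polyC_natr polyC_eq0 charF.
Qed.

Lemma qvar_neq0 (F : fieldType) : qvar F != 0.
Proof. by rewrite tofrac_eq0 polyX_eq0. Qed.

Lemma qvar_not_root1 (F : fieldType) (n : int) : n != 0 -> qvar F ^ n != 1.
Proof.
have qX m : qvar F ^+ m.+1 != 1.
  rewrite -[qvar F ^+ _](rmorphXn (@tofrac {poly F})) -tofrac1 tofrac_eq.
  apply/eqP => /(congr1 (fun p : {poly F} => size p)).
  by rewrite size_polyXn size_poly1.
case: n => [[//|m] _|m _]; first exact: qX.
by rewrite NegzE -invr_expz invr_eq1; apply: qX.
Qed.

Theorem theorem5p3
  (F : fieldType) (charF : [pchar F] =i pred0)
  (Kbar : closedFieldType)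
  (iota : {rmorphism {fraction {poly F}} -> Kbar})
  (Kbar_alg : forall z : Kbar, algebraicOver iota z)
  (k : nat) (l : k.-tuple int)
  (Q : qdiffop_fps {fraction {poly F}})
  (Q_coef : forall (n : nat) (j e : int), is_qlaurent (Q n j e))
  (Q_t : forall j : int, Q 0%N j = 0) :
  (exists g : 'I_k -> {fps {poly {laurent {fraction {poly F}}}}},
     free_basis (fps_scalar {fraction {poly F}}) (solution (qvar F) l Q) g)
  /\
  (exists (L : nat) (f : 'I_k -> {fps {poly {laurent Kbar}}}),
     [/\ (0 < L)%N,
         free_basis (laurent_scalar Kbar)
           (scalar_extension (laurent_scalar Kbar) (ext_map iota L)
              (solution (qvar F) l Q))
           (fun i => laurent_of_fps (f i))
       & forall i : 'I_k,
           exists (mu : {fps Kbar}) (h : {poly {fps {laurent Kbar}}}),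
             [/\ (mu - 1) 0%N = 0,
                 f i = xpow mu * fps_of_poly h
               & (size h <= k)%N]]).
Proof.
have charK := fraction_natr_neq0 charF.
have charC n : n.+1%:R != 0 :> Kbar.
  by rewrite -(rmorph_nat iota) fmorph_eq0 charK.
have [g [g_basis g_free0]] := solution_basis (@qvar_neq0 F) Q_t
  (@qvar_not_root1 F) charK iota (size_tuple l).
split; first by exists g.
have [solE _] := g_basis.
have g_sol i : solution (qvar F) l Q (g i).
  apply/solE; exists (fun j => (j == i)%:R).
  rewrite (bigD1 i) //= eqxx rmorph1 mul1r big1 ?addr0 // => j /negPf->.
  by rewrite rmorph0 mul0r.
have /choice[A AE] i :=
  (solE _).1 (solution_log_shift (@qvar_neq0 F) Q_t (g_sol i)).
pose A' : 'M[{fps Kbar}]_k := \matrix_(i, j) fps_map iota (A i j).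
(* The ramification index of the statement is [L.+1], the one that splits the characteristic
   polynomial of T. *)
have [L [rs]] := puiseux charC (char_poly_monic A').
rewrite map_char_poly; set B := map_mx _ A' => chB.
pose b i := fps_ext iota L (g i).
(* T acts on log_q x only, so it commutes with the change of field and with t = s^(L+1); its matrix
   undergoes the same substitutions. *)
have b_shift i :
    fps_map (@log_shift _) (b i) = \sum_j fps_scalar Kbar (B i j) * b j.
  transitivity (fps_ext iota L (fps_map (@log_shift _) (g i))).
    rewrite /b /fps_ext fps_map_ramify; congr fps_ramify.
    by apply/fpsP => n; apply/esym/laurent_poly_map_log_shift.
  rewrite AE rmorph_sum; apply: eq_bigr => j _.
  by rewrite rmorphM /= fps_ext_scalar !mxE.
have b_free0 (c : 'I_k -> Kbar) :
    \sum_i logconst Kbar (c i) * b i 0%N = 0 -> forall i, c i = 0.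
  move=> cb0; apply: g_free0; rewrite -[RHS]cb0.
  by apply: eq_bigr => i _; rewrite /b fps_ext0E.
have [W [U [WU UW W_log]]] := log_eigenbasis charC b_shift b_free0 chB.
exists L.+1, (fun i => \sum_j fps_scalar Kbar (W i j) * b j); split=> //.
exact: extended_basis WU UW.
Qed.
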